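(* Let $T$ be a theory of continuous first order logic and $\varphi(x,y)$ a formula which is stable in $T$. Let $A\subseteq M\models T$, and let $p\in \mathrm S_\varphi(A)$. Then there exists $q\in \mathrm S_\varphi(M)$ extending $p$ which is definable over $\mathrm{acl}(A)$.
   Context: **Continuous logic.** Truth values lie in $[0,1]$, $0$ meaning true. A (metric, possibly many-sorted) continuous signature $\mathcal L$ consists of function and predicate symbols of finite arities, a distinguished binary predicate symbol $d$ on each sort, and for each symbol and each argument a uniform continuity modulus. An $\mathcal L$-structure interprets function symbols by functions and predicate symbols by $[0,1]$-valued functions, with $d$ a complete metric and each symbol respecting its moduli in each argument. Formulae are built from atomic ones using the connectives $\neg x=1-x$, $x/2$, $x\dot- y=\max(x-y,0)$ and the quantifiers $\sup,\inf$. A condition is $\varphi=0$; a theory (not necessarily complete) is a set of conditions without free variables. Finite tuples of variables are treated as single variables. **Stability.** $\varphi(x,y)$ is $\varepsilon$-stable ($\varepsilon>0$) if in no model of $T$ is there an infinite sequence $(a_i,b_i)_{i<\omega}$ with $|\varphi(a_i,b_j)-\varphi(a_j,b_i)|\ge\varepsilon$ for all $i<j$; it is stable if $\varepsilon$-stable for all $\varepsilon>0$. **Types over models.** $\mathrm S_x(M)$ is the space of complete types over $M$ in the variable $x$, with the coarsest topology making $p\mapsto\psi^p$ continuous for every formula $\psi(x)$ with parameters in $M$ ($\psi^p$ being the value of $\psi$ at a realisation of $p$). $\mathrm S_\varphi(M)$ is the quotient space of $\mathrm S_x(M)$ identifying two types when they give the same value to $\varphi(x,b)$ for every $b\in M$.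 A $\varphi$-predicate over $M$ is a continuous function $\mathrm S_\varphi(M)\to[0,1]$. An $M$-definable predicate $\psi(y)$ is a continuous function $\mathrm S_y(M)\to[0,1]$ (equivalently a uniform limit of formulae with parameters in $M$), evaluated at $b$ in an elementary extension of $M$ through $\mathrm{tp}(b/M)$. The definition $d_q\varphi(y)$ of $q\in\mathrm S_\varphi(M)$ is the unique $M$-definable predicate $\psi(y)$ with $\varphi(x,b)^q=\psi(b)$ for all $b\in M$ (it exists since $\varphi$ is stable). **Types over sets.** All models are elementary substructures of a monster model $\mathfrak M$ ($\kappa$-saturated and strongly $\kappa$-homogeneous for a very large $\kappa$) of the relevant complete theory, and all parameter sets are small subsets of it. A $\varphi$-predicate over $A$ is a $\varphi$-predicate over $\mathfrak M$ which is $\mathrm{Aut}(\mathfrak M/A)$-invariant; $\mathrm S_\varphi(A)$ is the quotient space of $\mathrm S_\varphi(\mathfrak M)$ identifying types at which all $\varphi$-predicates over $A$ take equal values. (This agrees with the previous definition when $A$ is a model.) For $A\subseteq B$ there is a restriction map $\mathrm S_\varphi(B)\to\mathrm S_\varphi(A)$; $q$ extends $p$ if $p$ is its restriction. $q\in \mathrm S_\varphi(M)$ is definable over $B\subseteq M$ if $d_q\varphi$ is a $B$-definable predicate (equivalently, $\mathrm{Aut}(\mathfrak M/B)$-invariant). $\mathrm{acl}(A)$ is the set of all elements $b$ (of any sort) such that the set of realisations of $\mathrm{tp}(b/A)$ in $\mathfrak M$ is metrically compact; $\mathrm{acl}(A)\subseteq M$ for every model $M\supseteq A$. **Standing convention.**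 $\mathcal L$ is assumed to have, for every stable formula $\varphi(x,y)$, a sort $S_{d\varphi}$ of canonical parameters for instances of the predicate $d\varphi(y,X)$ defined as follows (so $\mathrm{acl}$ is computed with these sorts included). For a sequence $(a_n)$ in $[0,1]$ put $a_{*,0}=a_0$, let $a_{*,n+1}$ be the point of $[a_{*,n}-2^{-n-1},a_{*,n}+2^{-n-1}]$ closest to $a_{n+1}$, and $\mathrm{flim}_n a_n=\lim_n a_{*,n}$. $N(\varphi,\varepsilon)$ is the least $N$ such that in no model of $T$ is there a sequence $(a_i,b_i)_{i<N+1}$ with $|\varphi(a_j,b_i)-\varphi(a_j,b_k)|\ge\varepsilon$ for all $i<j<k$. $d^\varepsilon\varphi(y,x_{<2N(\varphi,\varepsilon)-1})$ is the median of the $2N(\varphi,\varepsilon)-1$ values $\varphi(x_i,y)$; $X=(x^n_i:n<\omega,i<2N(\varphi,2^{-n})-1)$ and $d\varphi(y,X)=\mathrm{flim}_n d^{2^{-n}}\varphi(y,x^n_{<2N(\varphi,2^{-n})-1})$. In a structure $M$, $S_{d\varphi}$ is the completion of the quotient of the set of families $C$ of elements of $M$ indexed like $X$ by the pseudo-metric $\sup_y|d\varphi(y,C)-d\varphi(y,C')|$, with the induced metric and with the predicate $P(y,[C])=d\varphi(y,C)$. Every $d_q\varphi$, $q\in\mathrm S_\varphi(M)$, equals $d\varphi(y,C)$ for some $C\subseteq M$. *)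

(* Defs.v *)
From HB Require Import structures.
From mathcomp Require Import all_boot all_order all_algebra.
From mathcomp Require Import all_classical all_reals topology normedtype.
Import Order.TTheory GRing.Theory Num.Theory numFieldNormedType.Exports.

Set Implicit Arguments.
Unset Strict Implicit.
Unset Printing Implicit Defensive.

Local Open Scope card_scope.
Local Open Scope classical_set_scope.
Local Open Scope ring_scope.

(** A finite tuple of variables is represented by the list of its sorts; a
    tuple of elements of these sorts is a function of the positions. *)

Fixpoint pos (S : Type) (Gamma : seq S) : Type :=
  if Gamma is _ :: Gamma' then option (pos Gamma') else void.

Fixpoint sortat (S : Type) (Gamma : seq S) : pos Gamma -> S :=
  match Gamma return pos Gamma -> S with
  | [::] => fun i => match i with end
  | s :: Gamma' => fun i => if i is Some j then sortat j else s
  end.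

Definition env (S : Type) (M : S -> Type) (Gamma : seq S) : Type :=
  forall i : pos Gamma, M (sortat i).

Definition enil (S : Type) (M : S -> Type) : env M [::] :=
  fun i => match i with end.

Definition econs (S : Type) (M : S -> Type) (s : S) (Gamma : seq S)
    (a : M s) (e : env M Gamma) : env M (s :: Gamma) :=
  fun i => match i return M (@sortat S (s :: Gamma) i) with
           | None => a
           | Some j => e j
           end.

Fixpoint ecat (S : Type) (M : S -> Type) (Gamma Delta : seq S) :
    env M Gamma -> env M Delta -> env M (Gamma ++ Delta) :=
  match Gamma return env M Gamma -> env M Delta -> env M (Gamma ++ Delta) with
  | [::] => fun _ d => d
  | s :: Gamma' => fun e d =>
      @econs S M s (Gamma' ++ Delta) (e None)
        (@ecat S M Gamma' Delta (fun j => e (Some j)) d)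
  end.

Definition emap (S : Type) (M N : S -> Type) (h : forall s, M s -> N s)
    (Gamma : seq S) (e : env M Gamma) : env N Gamma :=
  fun i => h _ (e i).

Definition esingle (S : Type) (M : S -> Type) (s : S) (a : M s) :
    env M [:: s] :=
  @econs S M s [::] a (@enil S M).

Definition epair (S : Type) (M : S -> Type) (s s' : S) (a : M s) (b : M s') :
    env M [:: s; s'] :=
  @econs S M s [:: s'] a (@esingle S M s' b).

Definition modulus (R : realType) : Type :=
  {delta : R -> R | forall eps, 0 < eps -> 0 < delta eps}.

Record signature (R : realType) := Signature {
  sorts : Type;
  fsym : seq sorts -> sorts -> Type;
  psym : seq sorts -> Type;
  dsym : forall s : sorts, psym [:: s; s];
  fmod : forall Gamma s, fsym Gamma s -> pos Gamma -> modulus R;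
  pmod : forall Gamma, psym Gamma -> pos Gamma -> modulus R }.

Notation ctx L := (seq (sorts L)).

Record structure (R : realType) (L : signature R) := Structure {
  carrier :> sorts L -> metricType R;
  carrier_inh : forall s, inhabited (carrier s);
  carrier_complete : forall s (F : set_system (carrier s)),
    ProperFilter F -> cauchy F -> exists a : carrier s, F --> a;
  ifun : forall (Gamma : ctx L) s, fsym Gamma s -> env carrier Gamma -> carrier s;
  ipred : forall Gamma : ctx L, psym Gamma -> env carrier Gamma -> R;
  ipred_itv : forall (Gamma : ctx L) (P : psym Gamma) (e : env carrier Gamma),
    0 <= ipred P e <= 1;
  ipred_dsym : forall s (a b : carrier s),
    ipred (dsym s) (@epair _ carrier s s a b) = mdist a b;
  ifun_mod : forall (Gamma : ctx L) s (f : fsym Gamma s) (i : pos Gamma)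
      (e e' : env carrier Gamma) (eps : R), 0 < eps ->
    (forall j, j <> i -> e j = e' j) ->
    mdist (e i) (e' i) < sval (fmod f i) eps ->
    mdist (ifun f e) (ifun f e') <= eps;
  ipred_mod : forall (Gamma : ctx L) (P : psym Gamma) (i : pos Gamma)
      (e e' : env carrier Gamma) (eps : R), 0 < eps ->
    (forall j, j <> i -> e j = e' j) ->
    mdist (e i) (e' i) < sval (pmod P i) eps ->
    `|ipred P e - ipred P e'| <= eps }.

Notation tup M Gamma := (@env _ (fun s => carrier M s) Gamma).

Inductive term (R : realType) (L : signature R) (Gamma : ctx L) :
    sorts L -> Type :=
| tvar (i : pos Gamma) : term Gamma (sortat i)
| tapp (Delta : ctx L) (s : sorts L) (f : fsym Delta s)
    (t : forall i : pos Delta, term Gamma (sortat i)) : term Gamma s.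

Inductive formula (R : realType) (L : signature R) : ctx L -> Type :=
| fatom (Gamma Delta : ctx L) (P : psym Delta)
    (t : forall i : pos Delta, term Gamma (sortat i)) : formula Gamma
| fneg (Gamma : ctx L) (f : formula Gamma) : formula Gamma
| fhalf (Gamma : ctx L) (f : formula Gamma) : formula Gamma
| fdotminus (Gamma : ctx L) (f g : formula Gamma) : formula Gamma
| fsup (Gamma : ctx L) (s : sorts L) (f : formula (s :: Gamma)) : formula Gamma
| finf (Gamma : ctx L) (s : sorts L) (f : formula (s :: Gamma)) : formula Gamma.

Section Semantics.
Variables (R : realType) (L : signature R).

Fixpoint teval (M : structure L) (Gamma : ctx L) (e : tup M Gamma) s
    (t : term Gamma s) : M s :=
  match t in term _ s0 return M s0 with
  | tvar i => e i
  | tapp Delta s0 f args => ifun f (fun i => teval e (args i))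
  end.

Fixpoint feval (M : structure L) (Gamma : ctx L) (phi : formula Gamma) :
    tup M Gamma -> R :=
  match phi in formula Gamma0 return tup M Gamma0 -> R with
  | fatom _ _ P t => fun e => ipred P (fun i => teval e (t i))
  | fneg _ f => fun e => 1 - feval f e
  | fhalf _ f => fun e => feval f e / 2
  | fdotminus _ f g => fun e => Num.max (feval f e - feval g e) 0
  | fsup _ s f => fun e => sup [set feval f (@econs (sorts L) (carrier M) s _ a e) | a in [set: M s]]
  | finf _ s f => fun e => inf [set feval f (@econs (sorts L) (carrier M) s _ a e) | a in [set: M s]]
  end.

(** A sentence [f] in a theory stands for the condition [f = 0]. *)
Definition theory := set (@formula R L [::]).

Definition models (M : structure L) (T : theory) : Prop :=
  forall f, T f -> feval f (@enil (sorts L) (carrier M)) = 0.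

Record elementary_embedding (M N : structure L) := ElementaryEmbedding {
  eemb :> forall s, M s -> N s;
  eembP : forall (Gamma : ctx L) (f : formula Gamma) (e : tup M Gamma),
    feval f (emap eemb e) = feval f e }.

Record automorphism (M : structure L) := Automorphism {
  autm :> forall s, M s -> M s;
  autm_bij : forall s, bijective (@autm s);
  autm_fun : forall (Gamma : ctx L) s (f : fsym Gamma s) (e : tup M Gamma),
    autm (ifun f e) = ifun f (emap autm e);
  autm_pred : forall (Gamma : ctx L) (P : psym Gamma) (e : tup M Gamma),
    ipred P (emap autm e) = ipred P e }.

Definition eps_stable (T : theory) (x y : ctx L) (phi : formula (x ++ y))
    (eps : R) : Prop :=
  ~ exists (M : structure L) (a : nat -> tup M x) (b : nat -> tup M y),
      models M T /\ forall i j, (i < j)%N ->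
        eps <= `|feval phi (ecat (a i) (b j)) - feval phi (ecat (a j) (b i))|.

Definition stable (T : theory) (x y : ctx L) (phi : formula (x ++ y)) : Prop :=
  forall eps, 0 < eps -> eps_stable T phi eps.

Definition no_alternation (T : theory) (x y : ctx L) (phi : formula (x ++ y))
    (eps : R) (N : nat) : Prop :=
  ~ exists (M : structure L) (a : 'I_N.+1 -> tup M x) (b : 'I_N.+1 -> tup M y),
      models M T /\ forall i j k : 'I_N.+1, (i < j < k)%N ->
        eps <= `|feval phi (ecat (a j) (b i)) - feval phi (ecat (a j) (b k))|.

(** [Nalt T phi eps] is $N(\varphi,\varepsilon)$; the default value [0] is
    only taken if there is no such number. *)
Definition Nalt (T : theory) (x y : ctx L) (phi : formula (x ++ y))
    (eps : R) : nat :=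
  xget 0%N [set N | no_alternation T phi eps N /\
                    forall N', no_alternation T phi eps N' -> (N <= N')%N].

Definition median (s : seq R) : R := nth 0 (sort <=%R s) (size s)./2.

Fixpoint slowed (u : nat -> R) (n : nat) : R :=
  if n is m.+1 then
    Num.max (slowed u m - 2 ^- m.+1) (Num.min (slowed u m + 2 ^- m.+1) (u m.+1))
  else u 0%N.

Definition flim (u : nat -> R) : R := limn (slowed u).

Definition dwidth (T : theory) (x y : ctx L) (phi : formula (x ++ y))
    (n : nat) : nat :=
  (2 * Nalt T phi (2 ^- n) - 1)%N.

Definition dfamily (T : theory) (x y : ctx L) (phi : formula (x ++ y))
    (M : structure L) : Type :=
  forall n : nat, 'I_(dwidth T phi n) -> tup M x.

Definition dphi (T : theory) (x y : ctx L) (phi : formula (x ++ y))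
    (M : structure L) (C : dfamily T phi M) (b : tup M y) : R :=
  flim (fun n => median [seq feval phi (ecat (C n i) b) | i : 'I_(dwidth T phi n)]).

(** [S] and [P] are the sort $S_{d\varphi}$ and its predicate $P(y,[C])$, where
    [cl C] is the class [C]: as [M S] is complete, the first two clauses say that
    it is the completion of the quotient of the families by the pseudo-metric. *)
Definition canonical_parameter_sort (T : theory) (x y : ctx L)
    (phi : formula (x ++ y)) (S : sorts L) (P : psym (y ++ [:: S])) : Prop :=
  forall M : structure L, models M T ->
    exists cl : dfamily T phi M -> M S,
      [/\ forall C C' : dfamily T phi M, mdist (cl C) (cl C') =
            sup [set `|dphi C b - dphi C' b| | b in [set: tup M y]],
          closure (range cl) = [set: M S]
        & forall (b : tup M y) (C : dfamily T phi M),
            ipred P (ecat b (@esingle (sorts L) (carrier M) S (cl C))) = dphi C b].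

Definition has_canonical_parameter_sorts (T : theory) : Prop :=
  forall (x y : ctx L) (phi : formula (x ++ y)), stable T phi ->
    exists (S : sorts L) (P : psym (y ++ [:: S])),
      canonical_parameter_sort T phi P.

Definition pset (M : structure L) : Type := forall s, set (M s).

Definition psub (M : structure L) (A B : pset M) : Prop :=
  forall s, A s `<=` B s.

Definition pfull (M : structure L) : pset M := fun s => [set: M s].

Arguments pfull M s _ : clear implicits.

Definition prange (M N : structure L) (h : elementary_embedding M N) : pset N :=
  fun s => range (@h s).

Definition inp (M : structure L) (B : pset M) (Gamma : ctx L)
    (e : tup M Gamma) : Prop :=
  forall i, B _ (e i).

Record pformula (M : structure L) (B : pset M) (x : ctx L) := PFormula {
  pctx : ctx L;
  pform : formula (x ++ pctx);
  ppar : tup M pctx;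
  pparP : inp B ppar }.

Arguments ppar {M B x} p _.
Arguments pparP {M B x} p _.

Definition pvalue (M : structure L) (B : pset M) (x : ctx L)
    (N : structure L) (h : elementary_embedding M N) (a : tup N x)
    (psi : pformula B x) : R :=
  feval (pform psi) (ecat a (emap h (ppar psi))).

Definition is_type (M : structure L) (B : pset M) (x : ctx L)
    (p : pformula B x -> R) : Prop :=
  exists (N : structure L) (h : elementary_embedding M N) (a : tup N x),
    p = pvalue h a.

(** $\mathrm S_x(B)$: a complete type is given by the values $\psi^p$; the set is
    then endowed with the initial topology for the maps $p\mapsto\psi^p$. *)
Definition ctype_ (M : structure L) (B : pset M) (x : ctx L) : Type :=
  {p : pformula B x -> R | is_type p}.

HB.instance Definition _ (M : structure L) (B : pset M) (x : ctx L) :=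
  gen_eqMixin (ctype_ B x).
HB.instance Definition _ (M : structure L) (B : pset M) (x : ctx L) :=
  gen_choiceMixin (ctype_ B x).

Definition ctype (M : structure L) (B : pset M) (x : ctx L) : Type :=
  initial_topology (fun p : ctype_ B x => sval p : {ptws pformula B x -> R}).

HB.instance Definition _ (M : structure L) (B : pset M) (x : ctx L) :=
  Topological.on (ctype B x).

Definition tvalue (M : structure L) (B : pset M) (x : ctx L) (p : ctype B x) :
    pformula B x -> R :=
  sval (p : ctype_ B x).

Definition eemb_id (M : structure L) : elementary_embedding M M :=
  @ElementaryEmbedding M M (fun s => id) (fun Gamma f e => erefl).

Definition tp (M : structure L) (B : pset M) (x : ctx L) (a : tup M x) :
    ctype B x :=
  exist _ (pvalue (eemb_id M) a)
    (ex_intro _ M (ex_intro _ (eemb_id M) (ex_intro _ a erefl))).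

Definition pwiden (M : structure L) (B B' : pset M) (BB' : psub B B')
    (x : ctx L) (psi : pformula B x) : pformula B' x :=
  @PFormula M B' x (pctx psi) (pform psi) (ppar psi)
    (fun i => BB' _ _ (pparP psi i)).

Lemma tres_subproof (M : structure L) (B B' : pset M) (BB' : psub B B')
    (x : ctx L) (p : ctype B' x) :
  is_type (fun psi : pformula B x => tvalue p (pwiden BB' psi)).
Proof.
case: (svalP (p : ctype_ B' x)) => N [h [a pE]]; exists N, h, a.
by rewrite /tvalue pE.
Qed.

Definition tres (M : structure L) (B B' : pset M) (BB' : psub B B')
    (x : ctx L) (p : ctype B' x) : ctype B x :=
  exist _ _ (tres_subproof BB' p).

Lemma psub_full (M : structure L) (B : pset M) : psub B (pfull M).
Proof. by move=> s a _. Qed.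

Definition inst (x y : ctx L) (phi : formula (x ++ y)) (M : structure L)
    (B : pset M) (b : tup M y) (Bb : inp B b) : pformula B x :=
  @PFormula M B x y phi b Bb.

Definition phi_rel (x y : ctx L) (phi : formula (x ++ y)) (M : structure L)
    (B : pset M) (p p' : ctype B x) : bool :=
  `[< forall (b : tup M y) (Bb : inp B b),
        tvalue p (inst phi Bb) = tvalue p' (inst phi Bb) >].

Lemma phi_rel_equiv (x y : ctx L) (phi : formula (x ++ y)) (M : structure L)
    (B : pset M) : equiv_class_of (@phi_rel x y phi M B).
Proof.
split=> [p|p q|q p r].
- exact/asboolP.
- by apply/asboolP/asboolP => pq b Bb; rewrite pq.
- by move=> /asboolP pq /asboolP qr; apply/asboolP => b Bb; rewrite pq.
Qed.

Canonical phi_equiv (x y : ctx L) (phi : formula (x ++ y)) (M : structure L)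
    (B : pset M) : equiv_rel (ctype B x) :=
  EquivRelPack (phi_rel_equiv phi B).

(** $\mathrm S_\varphi(B)$ as a quotient of $\mathrm S_x(B)$; to be used when
    [B] is a model. *)
Definition phitype (x y : ctx L) (phi : formula (x ++ y)) (M : structure L)
    (B : pset M) : Type :=
  quotient_topology {eq_quot (phi_equiv phi B)}%qT.

HB.instance Definition _ (x y : ctx L) (phi : formula (x ++ y))
  (M : structure L) (B : pset M) := Topological.on (phitype phi B).

Definition phicl (x y : ctx L) (phi : formula (x ++ y)) (M : structure L)
    (B : pset M) (p : ctype B x) : phitype phi B :=
  \pi_({eq_quot (phi_equiv phi B)})%qT p.

(** $\varphi(x,b)^q$, which does not depend on the representative. *)
Definition phivalue (x y : ctx L) (phi : formula (x ++ y)) (M : structure L)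
    (B : pset M) (q : phitype phi B) (b : tup M y) (Bb : inp B b) : R :=
  tvalue (repr (q : {eq_quot (phi_equiv phi B)}%qT)) (inst phi Bb).

Definition is_predicate (X : topologicalType) (f : X -> R) : Prop :=
  continuous f /\ forall t, 0 <= f t <= 1.

(** The cardinal $\kappa$ is represented by a type [K] of that cardinality. *)
Definition card_lt (S S' : Type) (X : set S) (Y : set S') : Prop :=
  (X #<= Y) /\ ~ (Y #<= X).

Definition small (K : Type) (U : structure L) (B : pset U) : Prop :=
  card_lt [set a : {s & U s} | B (projT1 a) (projT2 a)] [set: K].

Definition language_lt (K : Type) : Prop :=
  card_lt [set: (nat + sorts L + {Gamma : ctx L & psym Gamma}
                + {Gs : ctx L * sorts L & fsym Gs.1 Gs.2})%type] [set: K].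

Definition saturated (K : Type) (U : structure L) : Prop :=
  forall (B : pset U), small K B ->
  forall (x : ctx L) (p : ctype B x), exists a : tup U x, tp B a = p.

Definition elementary_on (U : structure L) (B : pset U)
    (f : forall s, U s -> U s) : Prop :=
  forall (Gamma : ctx L) (psi : formula Gamma) (e : tup U Gamma), inp B e ->
    feval psi (emap f e) = feval psi e.

Definition strongly_homogeneous (K : Type) (U : structure L) : Prop :=
  forall (B : pset U), small K B ->
  forall f : forall s, U s -> U s, elementary_on B f ->
    exists sigma : automorphism U, forall s (b : U s), B s b -> sigma s b = f s b.

Definition monster (K : Type) (U : structure L) : Prop :=
  [/\ language_lt K, saturated K U & strongly_homogeneous K U].

Definition fixes (U : structure L) (A : pset U) (sigma : automorphism U) : Prop :=
  forall s (a : U s), A s a -> sigma s a = a.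

Definition paut (U : structure L) (sigma : automorphism U) (x : ctx L)
    (psi : pformula (pfull U) x) : pformula (pfull U) x :=
  @PFormula U (pfull U) x (pctx psi) (pform psi) (emap sigma (ppar psi))
    (fun _ => I).

(** [p' = sigma p]: the value of $\psi(x,c)$ at [p] is that of
    $\psi(x,\sigma c)$ at [p']. *)
Definition aut_image (U : structure L) (sigma : automorphism U) (x : ctx L)
    (p p' : ctype (pfull U) x) : Prop :=
  forall psi, tvalue p' (paut sigma psi) = tvalue p psi.

Definition phi_predicate_over (x y : ctx L) (phi : formula (x ++ y))
    (U : structure L) (A : pset U) (f : phitype phi (pfull U) -> R) : Prop :=
  is_predicate f /\
  forall (sigma : automorphism U), fixes A sigma ->
  forall p p' : ctype (pfull U) x, aut_image sigma p p' ->
    f (phicl phi p') = f (phicl phi p).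

Definition phiset_rel (x y : ctx L) (phi : formula (x ++ y)) (U : structure L)
    (A : pset U) (r r' : phitype phi (pfull U)) : bool :=
  `[< forall f, phi_predicate_over A f -> f r = f r' >].

Lemma phiset_rel_equiv (x y : ctx L) (phi : formula (x ++ y))
    (U : structure L) (A : pset U) : equiv_class_of (@phiset_rel x y phi U A).
Proof.
split=> [p|p q|q p r].
- exact/asboolP.
- by apply/asboolP/asboolP => pq f fA; rewrite pq.
- by move=> /asboolP pq /asboolP qr; apply/asboolP => f fA; rewrite pq ?qr.
Qed.

Canonical phiset_equiv (x y : ctx L) (phi : formula (x ++ y))
    (U : structure L) (A : pset U) : equiv_rel (phitype phi (pfull U)) :=
  EquivRelPack (phiset_rel_equiv phi A).

(** $\mathrm S_\varphi(A)$ for an arbitrary subset [A] of the monster [U]. *)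
Definition phitype_set (x y : ctx L) (phi : formula (x ++ y))
    (U : structure L) (A : pset U) : Type :=
  quotient_topology {eq_quot (phiset_equiv phi A)}%qT.

HB.instance Definition _ (x y : ctx L) (phi : formula (x ++ y))
  (U : structure L) (A : pset U) := Topological.on (phitype_set phi A).

Definition phiset_cl (x y : ctx L) (phi : formula (x ++ y)) (U : structure L)
    (A : pset U) (r : phitype phi (pfull U)) : phitype_set phi A :=
  \pi_({eq_quot (phiset_equiv phi A)})%qT r.

(** For a model [B] containing [A], both [phitype phi B] and [phitype_set phi A]
    are quotients of $\mathrm S_x(\mathfrak M)$, and the restriction map is the
    one compatible with the quotient maps: [q] extends [p] if some global type
    has class [q] in the former and class [p] in the latter. *)
Definition extends (x y : ctx L) (phi : formula (x ++ y)) (U : structure L)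
    (B A : pset U) (q : phitype phi B) (p : phitype_set phi A) : Prop :=
  exists r : ctype (pfull U) x,
    phicl phi (tres (@psub_full U B) r) = q /\ phiset_cl A (phicl phi r) = p.

(** [psi] is the definition $d_q\varphi$ of [q]; for a model [B] it is unique,
    since the types $\mathrm{tp}(b/B)$ with $b$ in [B] are dense. *)
Definition is_definition (x y : ctx L) (phi : formula (x ++ y))
    (U : structure L) (B : pset U) (q : phitype phi B) (psi : ctype B y -> R) :
    Prop :=
  is_predicate psi /\
  forall (b : tup U y) (Bb : inp B b), psi (tp B b) = phivalue q Bb.

(** The definable predicate [psi] over [B] is also a definable predicate over
    [D]; both are evaluated on the monster [U], in which, [B] and [D] being
    small, all types over them are realised. *)
Definition definable_predicate_over (y : ctx L) (U : structure L)
    (B D : pset U) (psi : ctype B y -> R) : Prop :=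
  exists chi : ctype D y -> R, is_predicate chi /\
    forall b : tup U y, psi (tp B b) = chi (tp D b).

Definition definable_over (x y : ctx L) (phi : formula (x ++ y))
    (U : structure L) (B : pset U) (q : phitype phi B) (D : pset U) : Prop :=
  exists psi : ctype B y -> R,
    is_definition q psi /\ definable_predicate_over D psi.

Definition acl (U : structure L) (A : pset U) : pset U :=
  fun s => [set b | compact
    [set b' : U s | tp A (@esingle (sorts L) (carrier U) s b') = tp A (@esingle (sorts L) (carrier U) s b)]].

End Semantics.

Arguments ppar {R L M B x} p _.
Arguments pparP {R L M B x} p _.
Arguments pfull {R L} M s _.
Arguments prange {R L M N} h s _.
Arguments acl {R L U} A s _.

(* Main.v *)
From HB Require Import structures.
From mathcomp Require Import all_boot all_order all_algebra.
From mathcomp Require Import all_classical all_reals topology normedtype sequences.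
From mathcomp Require Import ring lra zify.
Require Import Defs.
Import Order.TTheory GRing.Theory Num.Theory numFieldNormedType.Exports.

Set Implicit Arguments.
Unset Strict Implicit.
Unset Printing Implicit Defensive.

Local Open Scope classical_set_scope.
Local Open Scope ring_scope.

(** A [phi]-type over the monster [U] is seen as the function sending [b] to the
    value of [phi(x, b)].  Those of the global types with class [p] over [A] form a
    set which is compact for pointwise convergence and invariant under
    [Aut(U / A)] acting by precomposition, that is, a flow
    ([extensions_subflow]).  By Zorn's lemma this flow contains a minimal one, [Z]
    ([minimal_subflow]).

    Stability makes [Z] small for the distance of uniform convergence.  For each
    [eps], some nonempty relatively open part of [Z] has diameter at most [eps]
    ([fragmentation]): otherwise [Z] would contain a binary tree whose branches have
    limits that are uniformly far apart, continuum many of them, whereas each limit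
    is close to a median of finitely many nodes of the tree
    ([median_approximation]).  By minimality finitely many translates of this open
    part cover [Z], so that [Z] is totally bounded
    ([minimal_subflow_totally_bounded]).

    Let [q] belong to [Z].  The same approximation by medians shows that the
    definition of [q] is an instance of [dphi], hence that [q] has a canonical
    parameter [c] ([dphi_adherent], [canonical_parameter]).  By homogeneity the
    realisations of the type of [c] over [A] are conjugate to [c], so they are the
    canonical parameters of functions in [Z]; as the distance of canonical
    parameters is the uniform distance, they form a totally bounded set, which is
    closed and therefore compact: [c] is algebraic over [A]
    ([totally_bounded_acl]).  Finally [c] lies in [M], since otherwise successive
    coheirs of its type over [M] would give an infinite separated set of
    realisations of its type over [A] ([acl_in_model]).  The predicate with
    parameter [c] is then at the same time the definition of the restriction of [q]
    to [M] and a predicate over the algebraic closure of [A].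

    Compactness enters through ultraproducts of structures ([Los]): they realise
    limits of types, and they show that the number bounding the alternations of a
    stable formula exists and is the same for some smaller [eps]
    ([no_alternation_exists], [no_alternation_slack]). *)

(** * Ultralimits of real numbers *)

Lemma expr_half_gt0 (R : realType) n : 0 < (2 : R) ^- n.
Proof. by rewrite invr_gt0 exprn_gt0. Qed.

Lemma expr_halfS (R : realType) n : (2 : R) ^- n.+1 = 2 ^- n / 2.
Proof. by rewrite exprS invfM mulrC. Qed.

Lemma expr_half_small (R : realType) (e : R) : 0 < e -> exists n, 2 ^- n < e.
Proof.
move=> e0.
have h : `|(2^-1 : R)| < 1 by rewrite ger0_norm ?invr_ge0// invf_lt1// ltr1n.
have /cvgrPdist_lt/(_ e e0)[n _ /(_ n (leqnn n))] := cvg_geometric (1 : R) h.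
rewrite /= sub0r normrN mul1r exprVn ger0_norm ?invr_ge0 ?exprn_ge0// => ?.
by exists n.
Qed.

Lemma ultrafilter_of_dichotomy (T : Type) (F : set_system T) :
  ProperFilter F -> (forall A, F A \/ F (~` A)) -> UltraFilter F.
Proof.
move=> FF FC; split=> // G GF FG; apply/seteqP; split=> // A GA.
have [//|FA] := FC A; exfalso; have /filter_ex[x []//] : G (A `&` ~` A).
by apply: filterI => //; exact: FG.
Qed.

Lemma ultrafilter_map (T U : Type) (f : T -> U) (F : set_system T) :
  UltraFilter F -> UltraFilter (f @ F).
Proof.
move=> FU; apply: ultrafilter_of_dichotomy => A.
have [?|?] := in_ultra_setVsetC (f @^-1` A) FU; [by left|by right].
Qed.

Section Ultralimit.
Variables (R : realType) (I : Type) (D : set_system I).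
Hypothesis UD : UltraFilter D.
Implicit Types u v : I -> R.

Lemma ultraI (P Q : set I) : D P -> D Q -> D (P `&` Q).
Proof. exact: filterI. Qed.

Definition ulim u : R := lim (u @ D).

Lemma ulim_cvg u : (forall i, 0 <= u i <= 1) -> u @ D --> ulim u.
Proof.
move=> u01; have UF : UltraFilter (u @ D) by exact: ultrafilter_map.
have := @segment_compact R 0 1; rewrite compact_ultra => /(_ _ UF)[].
  by apply: (@filterE _ D) => i; rewrite /= in_itv /=.
by move=> l [_ ul]; rewrite /ulim (cvg_lim (@Rhausdorff R) ul).
Qed.

Lemma ulim_eq u l : u @ D --> l -> ulim u = l.
Proof. exact: (cvg_lim (@Rhausdorff R)). Qed.

Lemma ulim_near u e : (forall i, 0 <= u i <= 1) -> 0 < e ->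
  \forall i \near D, `|ulim u - u i| < e.
Proof. by move=> /ulim_cvg /cvgrPdist_lt /(_ e). Qed.

Lemma cvgD_dist u l e : u @ D --> l -> 0 < e -> D [set i | `|l - u i| < e].
Proof. by move=> /cvgrPdist_lt/[apply]. Qed.

Lemma cvgD_le u v a b : u @ D --> a -> v @ D --> b ->
  (\forall i \near D, u i <= v i) -> a <= b.
Proof.
move=> ua vb uv; rewrite leNgt; apply/negP => ab.
have e0 : 0 < (a - b) / 2 by rewrite divr_gt0// subr_gt0.
have /filter_ex[i [[]]] : D ([set i | `|a - u i| < (a - b) / 2] `&`
    [set i | `|b - v i| < (a - b) / 2] `&` [set i | u i <= v i]).
  by apply: filterI => //; apply: filterI; exact: cvgD_dist.
by rewrite /= !ltr_distlC; lra.
Qed.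

Lemma ulim01 u : (forall i, 0 <= u i <= 1) -> 0 <= ulim u <= 1.
Proof.
move=> u01; have := ulim_cvg u01 => uc.
rewrite (cvgD_le (cvg_cst _) uc) ?(cvgD_le uc (cvg_cst _))//;
  by apply: filterE => i; case/andP: (u01 i).
Qed.

Lemma ulim_le u v : (forall i, 0 <= u i <= 1) -> (forall i, 0 <= v i <= 1) ->
  (\forall i \near D, u i <= v i) -> ulim u <= ulim v.
Proof. by move=> /ulim_cvg uc /ulim_cvg vc; exact: cvgD_le. Qed.

Lemma ulim_le_add u v c : (forall i, 0 <= u i <= 1) ->
  (forall i, 0 <= v i <= 1) ->
  (\forall i \near D, u i <= v i + c) -> ulim u <= ulim v + c.
Proof.
move=> /ulim_cvg uc /ulim_cvg vc.
exact: cvgD_le uc (cvgD vc (cvg_cst _)).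
Qed.

Lemma ulim_congr u v :
  (\forall i \near D, u i = v i) -> ulim u = ulim v.
Proof.
move=> uv; rewrite /ulim; congr (lim _); apply/seteqP; split=> A DA.
  have {}DA : D (u @^-1` A) by [].
  suff : D (v @^-1` A) by [].
  by apply: filterS (ultraI uv DA) => i [/= ->].
have {}DA : D (v @^-1` A) by [].
suff : D (u @^-1` A) by [].
by apply: filterS (ultraI uv DA) => i [/= ->].
Qed.

Lemma ulim_near_eq u l : (\forall i \near D, u i = l) -> ulim u = l.
Proof.
move=> ul; apply: ulim_eq; apply/cvgrPdist_lt => e e0.
by apply: filterS ul => i ->; rewrite subrr normr0.
Qed.

Lemma ulim_cst l : ulim (fun=> l) = l.
Proof. by apply: ulim_near_eq; apply: filterE. Qed.

Lemma ulim_dist_le u v c : (forall i, 0 <= u i <= 1) ->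
  (forall i, 0 <= v i <= 1) ->
  (\forall i \near D, `|u i - v i| <= c) -> `|ulim u - ulim v| <= c.
Proof.
move=> u01 v01 uv; rewrite ler_distlC; apply/andP; split.
  rewrite lerBlDr; apply: ulim_le_add => //.
  by apply: filterS uv => i; rewrite ler_distlC; lra.
by apply: ulim_le_add => //; apply: filterS uv => i; rewrite ler_distlC; lra.
Qed.

Lemma ulim_dist_ge u v c : (forall i, 0 <= u i <= 1) ->
  (forall i, 0 <= v i <= 1) ->
  (\forall i \near D, c <= `|u i - v i|) -> c <= `|ulim u - ulim v|.
Proof.
move=> /ulim_cvg uc /ulim_cvg vc; apply: (cvgD_le (cvg_cst c)).
by apply: cvg_norm; exact: cvgB.
Qed.

End Ultralimit.

(** * Formulas *)

Section BoundedRange.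
Variables (R : realType) (A : Type) (g : A -> R).
Hypotheses (A0 : inhabited A) (g01 : forall a, 0 <= g a <= 1).

Lemma range01_has_sup : has_sup [set g a | a in [set: A]].
Proof.
case: A0 => a; split; first by exists (g a), a.
by exists 1 => _ [b _ <-]; case/andP: (g01 b).
Qed.

Lemma range01_has_inf : has_inf [set g a | a in [set: A]].
Proof.
case: A0 => a; split; first by exists (g a), a.
by exists 0 => _ [b _ <-]; case/andP: (g01 b).
Qed.

Lemma sup_range_ge a : g a <= sup [set g a | a in [set: A]].
Proof. by apply: ub_le_sup; [case: range01_has_sup|exists a]. Qed.

Lemma inf_range_le a : inf [set g a | a in [set: A]] <= g a.
Proof. by apply: ge_inf; [case: range01_has_inf|exists a]. Qed.

Lemma sup_range_le c : (forall a, g a <= c) -> sup [set g a | a in [set: A]] <= c.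
Proof.
move=> gc; apply: ge_sup; first by case: range01_has_sup.
by move=> _ [a _ <-].
Qed.

Lemma inf_range_ge c : (forall a, c <= g a) -> c <= inf [set g a | a in [set: A]].
Proof.
move=> gc; apply: lb_le_inf; first by case: range01_has_inf.
by move=> _ [a _ <-].
Qed.

Lemma sup_range_approx e : 0 < e ->
  exists a, sup [set g a | a in [set: A]] - e < g a.
Proof.
move=> e0; have [_ [a _ <-]] := sup_adherent e0 range01_has_sup.
by exists a.
Qed.

Lemma inf_range_approx e : 0 < e ->
  exists a, g a < inf [set g a | a in [set: A]] + e.
Proof.
move=> e0; have [_ [a _ <-]] := inf_adherent e0 range01_has_inf.
by exists a.
Qed.

Lemma sup_range01 : 0 <= sup [set g a | a in [set: A]] <= 1.
Proof.
rewrite sup_range_le ?andbT => [|a]; last by case/andP: (g01 a).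
by case: A0 => a; apply: le_trans (sup_range_ge a); case/andP: (g01 a).
Qed.

Lemma inf_range01 : 0 <= inf [set g a | a in [set: A]] <= 1.
Proof.
rewrite inf_range_ge => [|a]; last by case/andP: (g01 a).
by case: A0 => a; apply: le_trans (inf_range_le a) _; case/andP: (g01 a).
Qed.

End BoundedRange.

Lemma env_eq (S : Type) (N : S -> Type) (Gamma : seq S) (e e' : env N Gamma) :
  (forall i, e i = e' i) -> e = e'.
Proof. exact: functional_extensionality_dep. Qed.

Lemma emap_cat (S : Type) (M N : S -> Type) (h : forall s, M s -> N s)
    (Gamma Delta : seq S) (e : env M Gamma) (d : env M Delta) :
  emap h (ecat e d) = ecat (emap h e) (emap h d).
Proof.
apply: functional_extensionality_dep; elim: Gamma e => [|s G IH] e // [i|] //.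
exact: (IH (fun j => e (Some j)) i).
Qed.

Local Notation mcons a e := (@econs _ (fun s => carrier _ s) _ _ a e).
Local Notation mcat e d := (@ecat _ (fun s => carrier _ s) _ _ e d).
Local Notation mmap h e := (@emap _ (fun s => carrier _ s) (fun s => carrier _ s) h _ e).

Section Semantics.
Variables (R : realType) (L : signature R).
Implicit Types (M N : structure L) (Gamma Delta : ctx L).

Lemma tup_inh M Gamma : inhabited (tup M Gamma).
Proof.
apply: inhabits => i; have := carrier_inh M (sortat i) => h.
by have := cid (let: inhabits a := h in ex_intro (fun=> True) a I) => -[].
Qed.

Lemma feval01 M Gamma (f : formula Gamma) (e : tup M Gamma) :
  0 <= feval f e <= 1.
Proof.
elim: f e => {Gamma} [Gamma Delta P t|Gamma f IH|Gamma f IH|Gamma f IHf g IHg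
  |Gamma s f IH|Gamma s f IH] e /=.
- exact: ipred_itv.
- by have := IH e; lra.
- by have := IH e; lra.
- have := IHf e; have := IHg e => g01 f01.
  by rewrite le_max lexx orbT ge_max ler01 andbT; lra.
- by apply: sup_range01 => //; exact: carrier_inh.
- by apply: inf_range01 => //; exact: carrier_inh.
Qed.

Lemma dist_sup_range_le (A : Type) (g h : A -> R) c : inhabited A ->
  (forall a, 0 <= g a <= 1) -> (forall a, 0 <= h a <= 1) ->
  (forall a, `|g a - h a| <= c) ->
  `|sup [set g a | a in [set: A]] - sup [set h a | a in [set: A]]| <= c.
Proof.
move=> A0 g01 h01 gh; rewrite ler_distlC; apply/andP; split.
  rewrite lerBlDr; apply: sup_range_le => // a.
  by have := gh a; have := sup_range_ge A0 h01 a; rewrite ler_distlC; lra.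
apply: sup_range_le => // a.
by have := gh a; have := sup_range_ge A0 g01 a; rewrite ler_distlC; lra.
Qed.

Lemma dist_inf_range_le (A : Type) (g h : A -> R) c : inhabited A ->
  (forall a, 0 <= g a <= 1) -> (forall a, 0 <= h a <= 1) ->
  (forall a, `|g a - h a| <= c) ->
  `|inf [set g a | a in [set: A]] - inf [set h a | a in [set: A]]| <= c.
Proof.
move=> A0 g01 h01 gh; rewrite ler_distlC; apply/andP; split.
  apply: inf_range_ge => // a.
  by have := gh a; have := inf_range_le A0 g01 a; rewrite ler_distlC; lra.
rewrite -lerBlDr; apply: inf_range_ge => // a.
by have := gh a; have := inf_range_le A0 h01 a; rewrite ler_distlC; lra.
Qed.

Lemma dist_dotminus_le (a b a' b' c : R) : `|a - a'| <= c -> `|b - b'| <= c ->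
  `|Num.max (a - b) 0 - Num.max (a' - b') 0| <= c + c.
Proof.
by rewrite !ler_distlC => h h'; rewrite !maxEle; do 2 case: ifP => ?; lra.
Qed.

Lemma common_modulus (Gamma : ctx L) (P : pos Gamma -> R -> Prop) :
  (forall i d d', 0 < d' -> d' <= d -> P i d -> P i d') ->
  (forall i, exists2 d : R, 0 < d & P i d) -> exists2 d : R, 0 < d & forall i, P i d.
Proof.
elim: Gamma P => [|s Gamma IH] P mono ex; first by exists 1 => // -[].
have [d1 d1p P1] := ex None.
have [d2 d2p P2] := IH (fun i => P (Some i)) (fun i => mono (Some i)) (fun i => ex (Some i)).
have d0 : 0 < Num.min d1 d2 by rewrite lt_min d1p.
exists (Num.min d1 d2) => // -[i|]; [apply: mono (P2 i)|apply: mono P1] => //;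
  by rewrite ge_min lexx ?orbT.
Qed.

(** Symbols are uniformly continuous in each argument; changing the arguments
    one after the other makes them jointly so, with a modulus that does not
    depend on the structure. *)
Lemma joint_modulus (Gamma : ctx L) (mu : pos Gamma -> modulus R) (eps : R) :
  0 < eps -> exists2 delta : R, 0 < delta &
  forall (N : sorts L -> metricType R) (X : Type) (dX : X -> X -> R)
    (G : env N Gamma -> X),
    (forall x, dX x x = 0) -> (forall x y z, dX x z <= dX x y + dX y z) ->
    (forall (i : pos Gamma) (e e' : env N Gamma) (c : R), 0 < c ->
      (forall j, j <> i -> e j = e' j) ->
      mdist (e i) (e' i) < sval (mu i) c -> dX (G e) (G e') <= c) ->
    forall e e' : env N Gamma, (forall i, mdist (e i) (e' i) < delta) ->
    dX (G e) (G e') <= eps.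
Proof.
elim: Gamma mu eps => [|s Gamma IH] mu eps eps0.
  exists 1 => // N X dX G d0 _ _ e e' _.
  by rewrite (_ : e' = e) ?d0 ?ltW//; apply: env_eq => -[].
have e20 : 0 < eps / 2 by rewrite divr_gt0.
have [d d0 Hd] := IH (fun i => mu (Some i)) _ e20.
set d1 := sval (mu None) (eps / 2).
have d10 : 0 < d1 by apply: (svalP (mu None)).
exists (Num.min d d1); first by rewrite lt_min d0.
move=> N X dX G dxx dtri HG e e' ee'.
pose cons1 (a : N s) (u : env N Gamma)  : env N (s :: Gamma) :=
    @econs _ N s Gamma a u.
have etaE (u : env N (s :: Gamma)) : u = cons1 (u None) (fun i => u (Some i)).
  by apply: env_eq => -[].
apply: le_trans (dtri _ (G (cons1 (e' None) (fun i => e (Some i)))) _) _.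
rewrite [leRHS]splitr; apply: lerD.
  apply: (HG None) => // [[i|]//|]; apply: lt_le_trans (ee' None) _.
  by rewrite ge_min lexx orbT.
rewrite {2}(etaE e').
apply: (Hd N X dX (fun u => G (cons1 (e' None) u))) => // [i u u' c c0 uu' uc|i].
  by apply: (HG (Some i)) => // -[j|] ji //=; apply: uu' => ?; apply: ji; congr Some.
by apply: lt_le_trans (ee' (Some i)) _; rewrite ge_min lexx.
Qed.

Lemma ifun_joint_modulus Gamma s (f : fsym Gamma s) (eps : R) : 0 < eps ->
  exists2 delta : R, 0 < delta & forall M (e e' : tup M Gamma),
    (forall i, mdist (e i) (e' i) < delta) -> mdist (ifun f e) (ifun f e') <= eps.
Proof.
move=> /(joint_modulus (fmod f))[d d0 H]; exists d => // M.
apply: (H (carrier M) _ (@mdist _ _) (@ifun R L M Gamma s f)) => //.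
- exact: mdistxx.
- exact: metric_triangle.
- exact: ifun_mod.
Qed.

Lemma ipred_joint_modulus Gamma (P : psym Gamma) (eps : R) : 0 < eps ->
  exists2 delta : R, 0 < delta & forall M (e e' : tup M Gamma),
    (forall i, mdist (e i) (e' i) < delta) -> `|ipred P e - ipred P e'| <= eps.
Proof.
move=> /(joint_modulus (pmod P))[d d0 H]; exists d => // M.
apply: (H (carrier M) _ (fun x y : R => `|x - y|) (@ipred R L M Gamma P)) => //.
- by move=> x; rewrite subrr normr0.
- by move=> x y z; rewrite -[x - z](subrKA y); exact: ler_normD.
- exact: ipred_mod.
Qed.

Lemma teval_modulus Gamma s (t : term Gamma s) (eps : R) : 0 < eps ->
  exists2 delta : R, 0 < delta & forall M (e e' : tup M Gamma),
    (forall i, mdist (e i) (e' i) < delta) -> mdist (teval e t) (teval e' t) <= eps.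
Proof.
elim: t eps => {s} [i|Delta s f t IH] eps eps0.
  by exists eps => // M e e' /(_ i)/ltW.
have [d d0 Hf] := ifun_joint_modulus f eps0.
have [] := @common_modulus Delta (fun i c => forall M (e e' : tup M Gamma),
    (forall k, mdist (e k) (e' k) < c) ->
    mdist (teval e (t i)) (teval e' (t i)) <= d / 2).
- move=> i c c' _ c'c H M e e' ee'; apply: H => k.
  exact: lt_le_trans (ee' k) c'c.
- by move=> i; apply: IH; rewrite divr_gt0.
move=> c c0 H; exists c => // M e e' ee'; apply: Hf => i.
by apply: le_lt_trans (H i M e e' ee') _; lra.
Qed.

Lemma feval_modulus Gamma (f : formula Gamma) (eps : R) : 0 < eps ->
  exists2 delta : R, 0 < delta & forall M (e e' : tup M Gamma),
    (forall i, mdist (e i) (e' i) < delta) -> `|feval f e - feval f e'| <= eps.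
Proof.
have econs_lt s Delta M (a : M s) (e e' : tup M Delta) d : 0 < d ->
    (forall i, mdist (e i) (e' i) < d) -> forall i : pos (s :: Delta),
    mdist (mcons a e i) (mcons a e' i) < d.
  by move=> d0 H [i|] //=; rewrite mdistxx.
elim: f eps => {Gamma} [Gamma Delta P t|Gamma f IH|Gamma f IH|Gamma f IHf g IHg
  |Gamma s f IH|Gamma s f IH] eps eps0.
- have [d d0 HP] := ipred_joint_modulus P eps0.
  have [] := @common_modulus Delta (fun i c => forall M (e e' : tup M Gamma),
    (forall k, mdist (e k) (e' k) < c) ->
    mdist (teval e (t i)) (teval e' (t i)) <= d / 2).
  + move=> i c c' _ c'c H M e e' ee'; apply: H => k.
    exact: lt_le_trans (ee' k) c'c.
  + by move=> i; apply: teval_modulus; rewrite divr_gt0.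
  move=> c c0 H; exists c => // M e e' ee'; apply: HP => i.
  by apply: le_lt_trans (H i M e e' ee') _; lra.
- have [d d0 H] := IH _ eps0; exists d => // M e e' /H /=.
  by rewrite !ler_distlC; lra.
- have [d d0 H] := IH _ eps0; exists d => // M e e' /H /=.
  by rewrite !ler_distlC; lra.
- have e20 : 0 < eps / 2 by rewrite divr_gt0.
  have [d d0 Hf] := IHf _ e20; have [d' d'0 Hg] := IHg _ e20.
  exists (Num.min d d'); first by rewrite lt_min d0.
  move=> M e e' ee' /=; rewrite [leRHS]splitr; apply: dist_dotminus_le.
    by apply: Hf => i; apply: lt_le_trans (ee' i) _; rewrite ge_min lexx.
  by apply: Hg => i; apply: lt_le_trans (ee' i) _; rewrite ge_min lexx orbT.
- have [d d0 H] := IH _ eps0; exists d => // M e e' ee' /=.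
  apply: dist_sup_range_le => [|a|a|a]; try exact: feval01.
    exact: carrier_inh.
  by apply: H; exact: econs_lt.
- have [d d0 H] := IH _ eps0; exists d => // M e e' ee' /=.
  apply: dist_inf_range_le => [|a|a|a]; try exact: feval01.
    exact: carrier_inh.
  by apply: H; exact: econs_lt.
Qed.

(** * Substitution *)

Definition substitution Gamma Delta : Type :=
  forall i : pos Gamma, term Delta (sortat i).

Fixpoint tsubst Gamma Delta (th : substitution Gamma Delta) s (t : term Gamma s) :
    term Delta s :=
  match t in term _ s0 return term Delta s0 with
  | tvar i => th i
  | tapp _ _ f args => tapp f (fun i => tsubst th (args i))
  end.

Definition shift s Delta : substitution Delta (s :: Delta) :=
  fun i => @tvar R L (s :: Delta) (Some i).

Definition slift s Gamma Delta (th : substitution Gamma Delta) :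
    substitution (s :: Gamma) (s :: Delta) :=
  fun i => match i return term (s :: Delta) (@sortat _ (s :: Gamma) i) with
           | None => @tvar R L (s :: Delta) None
           | Some k => tsubst (@shift s Delta) (th k)
           end.

Fixpoint fsubst Gamma (f : formula Gamma) : forall Delta,
    substitution Gamma Delta -> formula Delta :=
  match f in formula Gamma0 return
    forall Delta, substitution Gamma0 Delta -> formula Delta with
  | fatom _ _ P t => fun Delta th => fatom P (fun i => tsubst th (t i))
  | fneg _ f => fun Delta th => fneg (fsubst f th)
  | fhalf _ f => fun Delta th => fhalf (fsubst f th)
  | fdotminus _ f g => fun Delta th => fdotminus (fsubst f th) (fsubst g th)
  | fsup _ s f => fun Delta th => fsup (fsubst f (@slift s _ _ th))
  | finf _ s f => fun Delta th => finf (fsubst f (@slift s _ _ th))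
  end.

Lemma teval_subst M Gamma Delta (th : substitution Gamma Delta) (e : tup M Delta)
    s (t : term Gamma s) :
  teval e (tsubst th t) = teval (fun i => teval e (th i)) t.
Proof.
by elim: t => {s} [//|D s f t IH] /=; congr ifun; apply: env_eq.
Qed.

Lemma feval_subst M Gamma (f : formula Gamma) Delta (th : substitution Gamma Delta)
    (e : tup M Delta) :
  feval (fsubst f th) e = feval f (fun i => teval e (th i)).
Proof.
have liftE s G D (th' : substitution G D) (e' : tup M D) (a : M s) :
    (fun i => teval (mcons a e') (@slift s _ _ th' i)) =
    mcons a (fun i => teval e' (th' i)).
  apply: env_eq => -[i|] //=; rewrite teval_subst; congr teval.
elim: f Delta th e => {Gamma} [Gamma D P t|Gamma f IH|Gamma f IH|Gamma f IHf g IHg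
  |Gamma s f IH|Gamma s f IH] Delta th e /=.
- by congr ipred; apply: env_eq => i; rewrite teval_subst.
- by rewrite IH.
- by rewrite IH.
- by rewrite IHf IHg.
- by congr sup; apply: eq_imagel => a _; rewrite IH liftE.
- by congr inf; apply: eq_imagel => a _; rewrite IH liftE.
Qed.

Lemma left_substitution Gamma Delta : exists th : substitution Gamma (Gamma ++ Delta),
  forall M (e : tup M Gamma) (d : tup M Delta),
    (fun i => teval (mcat e d) (th i)) = e.
Proof.
elim: Gamma => [|s Gamma [th IH]].
  by exists (fun i : pos [::] => match i with end) => M e d; apply: env_eq => -[].
exists (@slift s _ _ th : substitution (s :: Gamma) ((s :: Gamma) ++ Delta)).
move=> M e d; apply: env_eq => -[i|] //=; rewrite teval_subst.
have := IH M (fun k => e (Some k)) d => /(congr1 (fun h => h i)) <-; congr teval.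
Qed.

Lemma right_substitution Gamma Delta : exists th : substitution Delta (Gamma ++ Delta),
  forall M (e : tup M Gamma) (d : tup M Delta),
    (fun i => teval (mcat e d) (th i)) = d.
Proof.
elim: Gamma => [|s Gamma [th IH]]; first by exists (fun i => tvar i).
exists (fun i => tsubst (@shift s (Gamma ++ Delta)) (th i)) => M e d.
apply: env_eq => i; rewrite teval_subst.
have := IH M (fun k => e (Some k)) d => /(congr1 (fun h => h i)) <-; congr teval.
Qed.

End Semantics.

(** * Approximate satisfaction of types *)

Section FiniteSatisfiability.
Variables (R : realType) (L : signature R).
Implicit Types (M N : structure L) (Gamma Delta x : ctx L).

Lemma cat_substitution x Gamma Delta (th : substitution Gamma Delta) :
  exists th' : substitution (x ++ Gamma) (x ++ Delta),
  forall M (a : tup M x) (d : tup M Delta),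
    (fun i => teval (mcat a d) (th' i)) = mcat a (fun i => teval d (th i)).
Proof.
elim: x => [|s x [th' IH]]; first by exists th.
exists (@slift R L s _ _ th' : substitution ((s :: x) ++ Gamma) ((s :: x) ++ Delta)).
move=> M a d; apply: env_eq => -[i|] //=; rewrite teval_subst.
by have /(congr1 (fun h => h i)) <- := IH M (fun k => a (Some k)) d.
Qed.

Fixpoint finfs x Gamma : formula (x ++ Gamma) -> formula Gamma :=
  match x return formula (x ++ Gamma) -> formula Gamma with
  | [::] => id
  | s :: x' => fun f => @finfs x' Gamma (@finf R L (x' ++ Gamma) s f)
  end.

Lemma finfs_le x Gamma (f : formula (x ++ Gamma)) M (a : tup M x) (d : tup M Gamma) :
  feval (finfs f) d <= feval f (mcat a d).
Proof.
elim: x f a => [|s x IH] f a //=.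
apply: le_trans (IH _ (fun k => a (Some k))) _ => /=.
apply: (inf_range_le (carrier_inh M s) (g := fun b => feval f (mcons b _))) => b.
exact: feval01.
Qed.

Lemma finfs_approx x Gamma (f : formula (x ++ Gamma)) M (d : tup M Gamma) (e : R) :
  0 < e -> exists a : tup M x, feval f (mcat a d) < feval (finfs f) d + e.
Proof.
elim: x f e => [|s x IH] f e e0 /=.
  by exists (@enil _ (carrier M)); rewrite ltrDl.
have e20 : 0 < e / 2 by rewrite divr_gt0.
have [a Ha] := IH (finf f) _ e20.
have [||b Hb] := inf_range_approx (g := fun b => feval f (mcons b (mcat a d))) _ _ e20.
- exact: carrier_inh.
- by move=> b; exact: feval01.
by exists (mcons b a) => /=; move: Ha Hb => /=; lra.
Qed.

(** Dyadic constants are expressible from any formula, which provides the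
    constant [0 = f - f]: the halving steps of a binary expansion are [c / 2] and
    [(1 + c) / 2]. *)
Lemma constant_formula Gamma (f0 : formula Gamma) (r e : R) : 0 <= r <= 1 -> 0 < e ->
  exists c : R, `|c - r| < e /\ exists k : formula Gamma, forall M (d : tup M Gamma),
    feval k d = c.
Proof.
move=> r01 e0.
have H n : forall r, 0 <= r <= 1 -> exists c : R, [/\ `|c - r| <= 2 ^- n, 0 <= c <= 1
    & exists k : formula Gamma, forall M (d : tup M Gamma), feval k d = c].
  elim: n => [|n IH] {r01}r r01.
    exists 0; split; [by rewrite expr0 invr1 ler_distlC; lra|by rewrite lexx ler01|].
    by exists (fdotminus f0 f0) => M d /=; rewrite subrr maxxx.
  have [rl|rl] := leP r (1 / 2).
    have [|c [cr c01 [k kE]]] := IH (2 * r); first by lra.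
    exists (c / 2); split; [|by lra|by exists (fhalf k) => M d /=; rewrite kE].
    rewrite (_ : c / 2 - r = (c - 2 * r) / 2); last by lra.
    by rewrite normrM (@ger0_norm _ 2^-1) ?invr_ge0// exprS invfM mulrC ler_pM2l ?invr_gt0.
  have [|c [cr c01 [k kE]]] := IH (2 * r - 1); first by lra.
  exists ((1 + c) / 2); split; [|by lra|exists (fneg (fhalf (fneg k))) => M d /=].
    rewrite (_ : (1 + c) / 2 - r = (c - (2 * r - 1)) / 2); last by lra.
    by rewrite normrM (@ger0_norm _ 2^-1) ?invr_ge0// exprS invfM mulrC ler_pM2l ?invr_gt0.
  by rewrite kE; lra.
have [n ne] := expr_half_small e0.
have [c [cr _ k]] := H n r r01; exists c; split=> //.
exact: le_lt_trans cr ne.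
Qed.

(** Both bounds of a basic neighbourhood of a value are conditions of the form
    [theta < 1 / 2]; this normal form is stable under finite intersections, by
    taking maxima.  For the upper bound one shifts [f] by a constant that brings [v]
    to [1 / 2]. *)
Lemma upper_test Gamma (f : formula Gamma) (v e : R) : 0 <= v <= 1 -> 0 < e ->
  exists th : formula Gamma, forall M (d : tup M Gamma),
    (feval f d <= v -> feval th d < 1 / 2) /\
    (feval th d < 1 / 2 -> feval f d < v + e).
Proof.
move=> v01 e0.
(* The threshold is placed in the middle of an interval of length at most 1/4, so
   that the constants below stay between 0 and 1. *)
pose e1 := Num.min e (1 / 4).
have e10 : 0 < e1 by rewrite lt_min e0/=; lra.
have e1e : e1 <= e by rewrite ge_min lexx.
have e14 : e1 <= 1 / 4 by rewrite ge_min lexx orbT.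
have e20 : 0 < e1 / 2 by rewrite divr_gt0.
have [vl|vl] := leP v (1 / 2 - e1 / 2).
  have [|c [cr [k kE]]] := constant_formula f (r := 1 / 2 - v - e1 / 2) _ e20.
    by lra.
  exists (fneg (fdotminus (fneg f) k)) => M d /=; rewrite kE.
  have := feval01 f d; move: cr; rewrite ltr_distlC => cr f01.
  by split; rewrite maxEle; case: ifP => ?; lra.
have [|c [cr [k kE]]] := constant_formula f (r := v - 1 / 2 + e1 / 2) _ e20.
  by lra.
exists (fdotminus f k) => M d /=; rewrite kE.
have := feval01 f d; move: cr; rewrite ltr_distlC => cr f01.
by split; rewrite maxEle; case: ifP => ?; lra.
Qed.

Definition fmax Gamma (f g : formula Gamma) : formula Gamma :=
  fneg (fdotminus (fneg f) (fdotminus g f)).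

Lemma feval_max Gamma (f g : formula Gamma) M (d : tup M Gamma) :
  feval (fmax f g) d = Num.max (feval f d) (feval g d).
Proof.
rewrite /=; have := feval01 f d; have := feval01 g d.
by rewrite !maxEle; do ?case: ifP; move=> *; lra.
Qed.

Variables (M N : structure L) (h : elementary_embedding M N) (x : ctx L) (a : tup N x).
Local Notation full := (@pfull R L M).

Let below (th : pformula full x) (m : tup M x) := pvalue (eemb_id M) m th < 1 / 2.

Let pmax (th th' : pformula full x) : exists th'' : pformula full x,
  (forall m, pvalue (eemb_id M) m th'' =
    Num.max (pvalue (eemb_id M) m th) (pvalue (eemb_id M) m th')) /\
  pvalue h a th'' = Num.max (pvalue h a th) (pvalue h a th').
Proof.
case: th th' => G f d dP [G' f' d' dP'].
have [l lE] := @left_substitution R L G G'; have [l' l'E] := cat_substitution x l.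
have [r rE] := @right_substitution R L G G'; have [r' r'E] := cat_substitution x r.
exists (@PFormula R L M full x (G ++ G') (fmax (fsubst f l') (fsubst f' r'))
  (mcat d d') (fun _ => I)).
by split=> [m|]; rewrite /pvalue [ppar _]/= emap_cat feval_max !feval_subst l'E r'E lE rE.
Qed.

(** Each condition [th < 1 / 2] satisfied by [a] holds somewhere in [M], because the
    infimum of [th] over tuples is the same in [M] and [N]; these conditions being
    stable under conjunction, the sets that they define in [M] generate a filter. *)
Lemma type_ultrafilter (f0 : pformula full x) :
  exists D : set_system (tup M x), UltraFilter D /\
  forall (psi : pformula full x) (e : R), 0 < e ->
    D [set m | `|pvalue (eemb_id M) m psi - pvalue h a psi| < e].
Proof.
have PF : ProperFilter (filter_from [set th | pvalue h a th < 1 / 2] below).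
  apply: filter_from_proper; last first.
    move=> [G f d dP]; rewrite /below /pvalue /= => fa.
    have : feval (finfs f) d < 1 / 2.
      by rewrite -(eembP h) (le_lt_trans (finfs_le _ a _)).
    rewrite -subr_gt0 => /finfs_approx-/(_ _ _ f M d)[m]; rewrite subrKC => mf.
    by exists m.
  apply: filter_from_filter.
    case: f0 => G f d dP; exists (@PFormula R L M full x G (fdotminus f f) d dP).
    by rewrite /pvalue /= subrr maxxx; lra.
  move=> th th' /= tha tha'; have [th'' [E Ea]] := pmax th th'.
  exists th''; first by rewrite /= Ea gt_max tha.
  by move=> m; rewrite /below E gt_max => /andP[].
have [D [UD FD]] := ultraFilterLemma PF; exists D; split=> // -[G f d dP] e e0.
have v01 : 0 <= feval f (mcat a (mmap h d)) <= 1 by exact: feval01.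
have [th thP] := upper_test f v01 e0.
have v'01 : 0 <= feval (fneg f) (mcat a (mmap h d)) <= 1 by exact: feval01.
have [th' th'P] := upper_test (fneg f) v'01 e0.
have D1 : D (below (@PFormula R L M full x G th d dP)).
  by apply: FD; exists (@PFormula R L M full x G th d dP) => //; apply: (thP _ _).1.
have D2 : D (below (@PFormula R L M full x G th' d dP)).
  by apply: FD; exists (@PFormula R L M full x G th' d dP) => //; apply: (th'P _ _).1.
apply: filterS (filterI D1 D2) => m [/(thP _ _).2 + /(th'P _ _).2].
by rewrite /pvalue /= ltr_distlC; lra.
Qed.

End FiniteSatisfiability.

(** * Ultraproducts *)

Lemma metric_cvgP (R : realType) (T : metricType R) (F : set_system T) (a : T) :
  Filter F -> F --> a <-> forall e, 0 < e -> F [set b | mdist a b < e].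
Proof.
move=> FF.
split=> [/fcvg_ballP H e /H|H]; first by rewrite near_simpl ballEmdist.
by apply/fcvg_ballP => e /H; rewrite near_simpl ballEmdist.
Qed.

Lemma metric_cauchyP (R : realType) (T : metricType R) (F : set_system T) :
  ProperFilter F -> cauchy F <-> forall e, 0 < e -> exists a, F [set b | mdist a b < e].
Proof.
move=> FF; split=> [/cauchyP H e /H[a]|H]; first by exists a; rewrite -ballEmdist.
by apply/cauchyP => e /H[a]; exists a; rewrite ballEmdist.
Qed.

Lemma mdist01 (R : realType) (L : signature R) (M : structure L) s (a b : M s) :
  0 <= mdist a b <= 1.
Proof. by rewrite -ipred_dsym; exact: ipred_itv. Qed.

Section GeometricSequence.
Variables (R : realType) (T : metricType R) (y : nat -> T).
Hypothesis y_dist : forall n, mdist (y n) (y n.+1) <= 2 ^- n.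

Lemma geometric_dist n k : mdist (y n) (y (n + k)%N) <= 2 * 2 ^- n.
Proof.
suff : mdist (y n) (y (n + k)%N) <= 2 * 2 ^- n - 2 * 2 ^- (n + k).
  by move=> /le_trans; apply; rewrite gerBl mulr_ge0// ltW// expr_half_gt0.
elim: k => [|k IH]; first by rewrite addn0 mdistxx subrr.
apply: le_trans (metric_triangle _ (y (n + k)%N) _) _.
by rewrite addnS; have := y_dist (n + k); rewrite expr_halfS; move: IH; lra.
Qed.

Lemma geometric_limit : (forall F : set_system T, ProperFilter F -> cauchy F ->
    exists a : T, F --> a) ->
  exists b, forall n, mdist (y n) b <= 2 * 2 ^- n.
Proof.
move=> complete; have [|b] := complete (y n @[n --> \oo]) _.
  apply/metric_cauchyP => e e0; have [n ne] : exists n, 2 ^- n < e / 2.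
    by apply: expr_half_small; rewrite divr_gt0.
  exists (y n), n => // m /= nm.
  have := geometric_dist n (m - n); rewrite subnKC// => /le_lt_trans; apply.
  by rewrite mulrC -ltr_pdivlMr.
move=> /metric_cvgP yb; exists b => n; apply/ler_addgt0Pl => e e0.
have [m _ Hm] := yb e e0.
apply: le_trans (metric_triangle _ (y (n + m)%N) _) _.
have := geometric_dist n m; have := Hm (n + m)%N (leq_addl _ _).
by rewrite /= (metric_sym b); lra.
Qed.

End GeometricSequence.

Lemma filter_pos (S I : Type) (D : set_system I) (Gamma : seq S)
    (P : pos Gamma -> set I) : Filter D ->
  (forall p, D (P p)) -> D [set i | forall p, P p i].
Proof.
move=> FD; elim: Gamma P => [|s Gamma IH] P HP; first by apply: filterE => i [].
have := IH (fun p => P (Some p)) (fun p => HP (Some p)).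
by move=> /(filterI (HP None)); apply: filterS => i [H1 H2] [p|].
Qed.

Lemma dependent_choice_fun (I : Type) (B : I -> Type) (P : forall i, B i -> Prop) :
  (forall i, exists b, P i b) -> exists f : forall i, B i, forall i, P i (f i).
Proof. by move=> H; exists (fun i => sval (cid (H i))) => i; case: cid. Qed.

Section Ultraproduct.
Variables (R : realType) (L : signature R) (I : Type) (D : set_system I).
Hypothesis UD : UltraFilter D.
Variable N : I -> structure L.

Definition uprod (s : sorts L) : Type := forall i, N i s.

HB.instance Definition _ s := gen_eqMixin (uprod s).
HB.instance Definition _ s := gen_choiceMixin (uprod s).

Let pdist s (f g : uprod s) : R := ulim D (fun i => mdist (f i) (g i)).

Let dist01 s (f g : uprod s) i : 0 <= mdist (f i) (g i) <= 1.
Proof. exact: mdist01. Qed.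

Let pdist_triangle s (f g h : uprod s) : pdist f h <= pdist f g + pdist g h.
Proof.
have fg := ulim_cvg UD (dist01 f g); have gh := ulim_cvg UD (dist01 g h).
apply: (cvgD_le UD (ulim_cvg UD (dist01 f h)) (cvgD fg gh)).
by apply: filterE => i; exact: metric_triangle.
Qed.

Let pdist_sym s (f g : uprod s) : pdist f g = pdist g f.
Proof. by rewrite /pdist; congr ulim; apply: funext => i; rewrite metric_sym. Qed.

Let pdistxx s (f : uprod s) : pdist f f = 0.
Proof. by apply: ulim_near_eq; apply: filterE => i; rewrite mdistxx. Qed.

Let pdist_ge0 s (f g : uprod s) : 0 <= pdist f g.
Proof. by have /andP[] := ulim01 UD (dist01 f g). Qed.

Definition ueq s (f g : uprod s) : bool := `[< pdist f g = 0 >].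

Lemma ueq_equiv s : equiv_class_of (@ueq s).
Proof.
split=> [f|f g|g f h]; first exact/asboolP/pdistxx.
  by rewrite /ueq pdist_sym.
move=> /asboolP fg /asboolP gh; apply/asboolP/eqP.
by rewrite eq_le pdist_ge0 (le_trans (pdist_triangle _ g _))// fg gh addr0.
Qed.

Canonical ueq_rel s : equiv_rel (uprod s) := EquivRelPack (ueq_equiv s).

Definition ucar (s : sorts L) : Type := {eq_quot (ueq_rel s)}%qT.

HB.instance Definition _ s := Choice.on (ucar s).

Definition ucls s (f : uprod s) : ucar s := \pi_({eq_quot (ueq_rel s)})%qT f.

Definition urep s (a : ucar s) : uprod s := repr (a : {eq_quot (ueq_rel s)}%qT).

Lemma ucls_rep s (a : ucar s) : ucls (urep a) = a.
Proof. exact: reprK. Qed.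

Let uclsP s (f g : uprod s) : ucls f = ucls g <-> pdist f g = 0.
Proof. by split=> [/eqmodP/asboolP|fg]; [|apply/eqmodP/asboolP]. Qed.

Let pdist_rep s (f g : uprod s) : pdist (urep (ucls f)) (urep (ucls g)) = pdist f g.
Proof.
have H h : pdist (urep (ucls h)) h = 0 by apply/uclsP; rewrite ucls_rep.
have := pdist_triangle (urep (ucls f)) f (urep (ucls g)).
have := pdist_triangle f g (urep (ucls g)).
have := pdist_triangle f (urep (ucls f)) g.
have := pdist_triangle (urep (ucls f)) (urep (ucls g)) g.
rewrite (pdist_sym f (urep _)) (pdist_sym g (urep _)) !H.
by move=> *; apply: le_anti; apply/andP; split; lra.
Qed.

Definition udist s (a b : ucar s) : R := pdist (urep a) (urep b).

Let udistxx s (a : ucar s) : udist a a = 0. Proof. exact: pdistxx. Qed.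

Let udist_pos s (a b : ucar s) : udist a b = 0 -> a = b.
Proof. by move=> /uclsP; rewrite !ucls_rep. Qed.

Let udist_sym s (a b : ucar s) : udist a b = udist b a.
Proof. exact: pdist_sym. Qed.

Let udist_triangle s (b a c : ucar s) : udist a c <= udist a b + udist b c.
Proof. exact: pdist_triangle. Qed.

HB.instance Definition _ s := @isMetric.Build R (ucar s) (@udist s)
  (@udistxx s) (@udist_pos s) (@udist_sym s) (@udist_triangle s).

Definition ucarrier (s : sorts L) : metricType R := ucar s.

Lemma mdist_ucls s (f g : uprod s) :
  mdist (ucls f : ucarrier s) (ucls g) = ulim D (fun i => mdist (f i) (g i)).
Proof. exact: pdist_rep. Qed.

Lemma ucarrier_inh s : inhabited (ucarrier s).
Proof.
apply: inhabits; apply: (@ucls s) => i; have := carrier_inh (N i) s => h.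
by have := cid (let: inhabits a := h in ex_intro (fun=> True) a Logic.I) => -[].
Qed.

Lemma ulim_lt_near (u : I -> R) c : (forall i, 0 <= u i <= 1) -> ulim D u < c ->
  D [set i | u i < c].
Proof.
move=> u01; rewrite -subr_gt0 => /(ulim_near UD u01); apply: filterS => i /=.
by rewrite ltr_distlC; lra.
Qed.

(** From representatives of a rapidly converging sequence, each coordinate keeps the
    longest initial segment that converges rapidly in that coordinate, so that its
    limit exists there; this works for every ultrafilter. *)
Lemma ucarrier_complete s (F : set_system (ucarrier s)) :
  ProperFilter F -> cauchy F -> exists a : ucarrier s, F --> a.
Proof.
move=> FF /metric_cauchyP Fc.
have /choice[a aF] n : exists a : ucarrier s, F [set b | mdist a b < 2 ^- n.+2].
  exact/Fc/expr_half_gt0.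
have a_dist n : mdist (a n) (a n.+1) < 2 ^- n.
  have /filter_ex[b [/= ab ab']] : F ([set b | mdist (a n) b < 2 ^- n.+2] `&`
      [set b | mdist (a n.+1) b < 2 ^- n.+3]) by exact: filterI.
  apply: le_lt_trans (metric_triangle _ b _) _; rewrite (metric_sym b).
  move: ab ab'; rewrite (expr_halfS _ n.+2) (expr_halfS _ n.+1) (expr_halfS _ n).
  by have := expr_half_gt0 R n; lra.
pose r n : uprod s := urep (a n).
pose good n i := forall m, (m < n)%N -> mdist (r m i) (r m.+1 i) < 2 ^- m.
have good_near n : D [set i | good n i].
  elim: n => [|n IH]; first by apply: filterE.
  have := ulim_lt_near (dist01 (r n) (r n.+1)) (a_dist n).
  move=> /(filterI IH); apply: filterS => i [gn rn] m.
  by rewrite ltnS leq_eqVlt => /orP[/eqP ->|/gn].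
pose y i := fix y n := if n is m.+1 then
  if pselect (good m.+1 i) then r m.+1 i else y m else r 0%N i.
have y_good i n : good n i -> y i n = r n i.
  by case: n => //= n gn; case: pselect.
have y_dist i n : mdist (y i n) (y i n.+1) <= 2 ^- n.
  have [gn|ngn] := pselect (good n.+1 i).
    rewrite (y_good _ _ gn) y_good; first exact/ltW/gn.
    by move=> m mn; apply: gn; exact: leq_trans mn _.
  rewrite /=; case: (pselect (good n.+1 i)) => [/ngn//|?].
  by rewrite mdistxx ltW// expr_half_gt0.
have H i : exists b : N i s, forall n, mdist (y i n) b <= 2 * 2 ^- n.
  by apply: geometric_limit; [exact: y_dist|exact: carrier_complete].
have [b bP] := dependent_choice_fun H.
exists (ucls (b : uprod s)); apply/metric_cvgP => e e0.
have [n ne] : exists n, 2 ^- n < e / 4 by apply: expr_half_small; rewrite divr_gt0.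
apply: filterS (aF n) => c /= ac.
apply: le_lt_trans (metric_triangle _ (a n) _) _.
have : mdist (a n) (ucls (b : uprod s)) <= 2 * 2 ^- n.
  rewrite -(ucls_rep (a n)) mdist_ucls.
  apply: (cvgD_le UD (ulim_cvg UD (dist01 _ _)) (cvg_cst _)).
  by apply: filterS (good_near n) => i /y_good yr; have := bP i n; rewrite yr.
rewrite metric_sym; move: ac; rewrite !expr_halfS.
by have := expr_half_gt0 R n; lra.
Qed.

Let rep Gamma (e : env ucarrier Gamma) i : tup (N i) Gamma :=
  fun p => urep (e p) i.

Definition uifun Gamma s (f : fsym Gamma s) (e : env ucarrier Gamma) : ucarrier s :=
  ucls (fun i => ifun f (rep e i)).

Definition uipred Gamma (P : psym Gamma) (e : env ucarrier Gamma) : R :=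
  ulim D (fun i => ipred P (rep e i)).

Let rep_near Gamma (q : pos Gamma) (e e' : env ucarrier Gamma) c :
  (forall j, j <> q -> e j = e' j) -> mdist (e q) (e' q) < c ->
  D [set i | (forall j, j <> q -> rep e i j = rep e' i j) /\
             mdist (rep e i q) (rep e' i q) < c].
Proof.
move=> ee' /(ulim_lt_near (dist01 _ _)); apply: filterS => i ?; split=> // j.
by rewrite /rep => /ee' ->.
Qed.

Lemma uifun_mod Gamma s (f : fsym Gamma s) (q : pos Gamma)
    (e e' : env ucarrier Gamma) (eps : R) : 0 < eps ->
  (forall j, j <> q -> e j = e' j) ->
  mdist (e q) (e' q) < sval (fmod f q) eps ->
  mdist (uifun f e) (uifun f e') <= eps.
Proof.
move=> eps0 ee' eq; rewrite mdist_ucls.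
apply: (cvgD_le UD (ulim_cvg UD (dist01 _ _)) (cvg_cst _)).
by apply: filterS (rep_near ee' eq) => i [H1 H2]; exact: ifun_mod H2.
Qed.

Lemma uipred_mod Gamma (P : psym Gamma) (q : pos Gamma)
    (e e' : env ucarrier Gamma) (eps : R) : 0 < eps ->
  (forall j, j <> q -> e j = e' j) ->
  mdist (e q) (e' q) < sval (pmod P q) eps ->
  `|uipred P e - uipred P e'| <= eps.
Proof.
move=> eps0 ee' eq; apply: ulim_dist_le => [i|i|]; try exact: ipred_itv.
by apply: filterS (rep_near ee' eq) => i [H1 H2]; exact: ipred_mod H2.
Qed.

Lemma uipred_itv Gamma (P : psym Gamma) (e : env ucarrier Gamma) :
  0 <= uipred P e <= 1.
Proof. by apply: ulim01 => i; exact: ipred_itv. Qed.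

Lemma uipred_dsym s (a b : ucarrier s) :
  uipred (dsym s) (@epair _ ucarrier s s a b) = mdist a b.
Proof.
rewrite -{2}(ucls_rep a) -{2}(ucls_rep b) mdist_ucls /uipred; congr ulim.
apply: funext => i; rewrite -ipred_dsym; congr ipred.
by apply: env_eq => -[[[]|]|].
Qed.

Definition ultraproduct : structure L :=
  Structure ucarrier_inh ucarrier_complete uipred_itv uipred_dsym uifun_mod uipred_mod.

Definition uclass s (f : forall i, N i s) : ultraproduct s := @ucls s f.

Definition utuple Gamma (g : forall i, tup (N i) Gamma) : tup ultraproduct Gamma :=
  fun p => uclass (fun i => g i p).

Let utuple_near Gamma (g : forall i, tup (N i) Gamma) c : 0 < c ->
  D [set i | forall p, mdist (rep (utuple g) i p) (g i p) < c].
Proof.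
move=> c0; apply: filter_pos => p.
apply: (ulim_lt_near (dist01 _ _)).
rewrite (_ : ulim _ _ = 0)//; apply/(uclsP (urep _) (fun i => g i p)).
by rewrite ucls_rep.
Qed.

Lemma ifun_utuple Gamma s (f : fsym Gamma s) (g : forall i, tup (N i) Gamma) :
  ifun f (utuple g) = uclass (fun i => ifun f (g i)).
Proof.
apply/uclsP/eqP; rewrite eq_le pdist_ge0 andbT.
apply/ler_addgt0Pl => c c0; rewrite addr0.
have [d d0 Hd] := ifun_joint_modulus f c0.
apply: (cvgD_le UD (ulim_cvg UD (dist01 _ _)) (cvg_cst _)).
by apply: filterS (utuple_near g d0) => i /Hd.
Qed.

Lemma ipred_utuple Gamma (P : psym Gamma) (g : forall i, tup (N i) Gamma) :
  ipred P (utuple g) = ulim D (fun i => ipred P (g i)).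
Proof.
apply/eqP; rewrite -subr_eq0 -normr_le0; apply/ler_addgt0Pl => c c0; rewrite addr0.
have [d d0 Hd] := ipred_joint_modulus P c0.
apply: ulim_dist_le => [i|i|]; try exact: ipred_itv.
by apply: filterS (utuple_near g d0) => i /Hd.
Qed.

Lemma teval_utuple Gamma s (t : term Gamma s) (g : forall i, tup (N i) Gamma) :
  teval (utuple g) t = uclass (fun i => teval (g i) t).
Proof.
elim: t => {s} [//|Delta s f t IH] /=.
rewrite -(ifun_utuple f (fun i p => teval (g i) (t p))).
by congr (@ifun R L ultraproduct); apply: env_eq.
Qed.

Let utuple_cons Gamma s (a : ultraproduct s) (g : forall i, tup (N i) Gamma) :
  mcons a (utuple g) = utuple (fun i => mcons (urep a i) (g i)).
Proof. by apply: env_eq => -[p|] //=; rewrite /utuple /uclass -[LHS]ucls_rep. Qed.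

Let utuple_consE Gamma s (a : forall i, N i s) (g : forall i, tup (N i) Gamma) :
  mcons (uclass a) (utuple g) = utuple (fun i => mcons (a i) (g i)).
Proof. by apply: env_eq => -[p|]. Qed.

(** For the quantifiers, elements which almost reach the supremum or the infimum
    are chosen in each factor. *)
Theorem Los Gamma (f : formula Gamma) (g : forall i, tup (N i) Gamma) :
  feval f (utuple g) = ulim D (fun i => feval f (g i)).
Proof.
elim: f g => {Gamma} [Gamma Delta P t|Gamma f IH|Gamma f IH|Gamma f IHf h IHh
  |Gamma s f IH|Gamma s f IH] g /=.
- rewrite -(ipred_utuple P (fun i p => teval (g i) (t p))).
  by congr (@ipred R L ultraproduct); apply: env_eq => p; rewrite teval_utuple.
- rewrite IH; apply/esym/ulim_eq; apply: cvgB; first exact: cvg_cst.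
  by apply: ulim_cvg => // i; exact: feval01.
- rewrite IH; apply/esym/ulim_eq; apply: cvgMl.
  by apply: ulim_cvg => // i; exact: feval01.
- rewrite IHf IHh; apply/esym/ulim_eq.
  pose u i := feval f (g i) - feval h (g i).
  have uc : u @ D --> ulim D (fun i => feval f (g i)) - ulim D (fun i => feval h (g i)).
    by apply: cvgB; apply: ulim_cvg => // i; exact: feval01.
  apply/cvgrPdist_lt => e e0; apply: filterS (cvgD_dist UD uc e0) => i /=.
  by rewrite -/(u i) !maxEle !ltr_distlC; do 2 case: ifP => ?; lra.
- have f01 i : 0 <= sup [set feval f (mcons a (g i)) | a in [set: N i s]] <= 1.
    by apply: sup_range01 => [|a]; [exact: carrier_inh|exact: feval01].
  apply/eqP; rewrite eq_le; apply/andP; split.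
    apply: sup_range_le => [||a]; [exact: (carrier_inh ultraproduct s)|by move=> a; exact: feval01|].
    rewrite utuple_cons IH; apply: ulim_le => // [i|]; first exact: feval01.
    apply: filterE => i; apply: (sup_range_ge (g := fun a => feval f (mcons a (g i)))) => [|b].
      exact: carrier_inh.
    exact: feval01.
  apply/ler_addgt0Pr => e e0.
  have /dependent_choice_fun[a aP] i : exists a : N i s, sup [set feval f (mcons a (g i)) | a in [set: N i s]] - e <
      feval f (mcons a (g i)).
    by apply: sup_range_approx => // [|a]; [exact: carrier_inh|exact: feval01].
  apply: (@le_trans _ _ (feval f (mcons (uclass a) (utuple g)) + e)); last first.
    rewrite lerD2r; apply: (sup_range_ge (g := fun a => feval f (mcons a (utuple g)))) => [|b].
      exact: carrier_inh.
    exact: feval01.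
  rewrite utuple_consE IH; apply: ulim_le_add => // [i|]; first exact: feval01.
  by apply: filterE => i; rewrite -lerBlDr ltW.
- have f01 i : 0 <= inf [set feval f (mcons a (g i)) | a in [set: N i s]] <= 1.
    by apply: inf_range01 => [|a]; [exact: carrier_inh|exact: feval01].
  apply/eqP; rewrite eq_le; apply/andP; split; last first.
    apply: inf_range_ge => [||a]; [exact: (carrier_inh ultraproduct s)|by move=> a; exact: feval01|].
    rewrite utuple_cons IH; apply: ulim_le => // [i|]; first exact: feval01.
    apply: filterE => i; apply: (inf_range_le (g := fun a => feval f (mcons a (g i)))) => [|b].
      exact: carrier_inh.
    exact: feval01.
  apply/ler_addgt0Pr => e e0.
  have /dependent_choice_fun[a aP] i : exists a : N i s, feval f (mcons a (g i)) <
      inf [set feval f (mcons a (g i)) | a in [set: N i s]] + e.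
    by apply: inf_range_approx => // [|a]; [exact: carrier_inh|exact: feval01].
  apply: (@le_trans _ _ (feval f (mcons (uclass a) (utuple g)))).
    apply: (inf_range_le (g := fun a => feval f (mcons a (utuple g)))) => [|b].
      exact: carrier_inh.
    exact: feval01.
  rewrite utuple_consE IH; apply: ulim_le_add => // [i|]; first exact: feval01.
  by apply: filterE => i; rewrite ltW.
Qed.

Lemma models_ultraproduct (T : theory L) :
  (forall i, models (N i) T) -> models ultraproduct T.
Proof.
move=> NT f Tf; rewrite (_ : @enil _ _ = utuple (fun i => @enil _ (carrier (N i)))).
  by rewrite Los; apply: ulim_near_eq; apply: filterE => i; exact: NT.
by apply: env_eq => -[].
Qed.

Variables (M : structure L) (h : forall i, elementary_embedding M (N i)).

Lemma diagonal_elementary Gamma (f : formula Gamma) (e : tup M Gamma) :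
  feval f (mmap (fun s (a : M s) => uclass (fun i => h i s a)) e) = feval f e.
Proof.
rewrite (_ : mmap _ e = utuple (fun i => mmap (h i) e))// Los.
by apply: ulim_near_eq; apply: filterE => i; exact: eembP.
Qed.

Definition diagonal : elementary_embedding M ultraproduct :=
  ElementaryEmbedding diagonal_elementary.

End Ultraproduct.

(** * Alternations in stable formulas *)

Lemma greedy_sequence (T : Type) (step : seq T -> T -> Prop) :
  (forall s, exists y, step s y) -> exists f : nat -> T, forall n, step (mkseq f n) (f n).
Proof.
move=> /choice[next nextP].
pose F := fix F n := if n is m.+1 then rcons (F m) (next (F m)) else [::].
exists (fun n => next (F n)) => n.
suff -> : mkseq (fun n => next (F n)) n = F n by exact: nextP.
by elim: n => // n IH; rewrite mkseqS IH.
Qed.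

Lemma greedy_pairs (T : Type) (x0 : T) (P : T -> Prop) (Q : T -> T -> Prop) :
  (forall n (g : nat -> T), (forall i, (i < n)%N -> P (g i)) ->
    exists y, P y /\ forall i, (i < n)%N -> Q (g i) y) ->
  exists f : nat -> T, (forall n, P (f n)) /\ forall i j, (i < j)%N -> Q (f i) (f j).
Proof.
move=> H.
have [s|f fP] := @greedy_sequence T (fun s y =>
    (forall i, (i < size s)%N -> P (nth x0 s i)) ->
    P y /\ forall i, (i < size s)%N -> Q (nth x0 s i) y).
  have [Ps|nPs] := pselect (forall i, (i < size s)%N -> P (nth x0 s i)).
    by have [y yP] := H _ _ Ps; exists y.
  by exists x0 => /nPs.
have {}fP n : (forall i, (i < n)%N -> P (f i)) ->
    P (f n) /\ forall i, (i < n)%N -> Q (f i) (f n).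
  move=> Pf; have := fP n; rewrite size_mkseq => -[i i_n|Pn Qn].
    by rewrite nth_mkseq//; exact: Pf.
  by split=> // i i_n; have := Qn i i_n; rewrite nth_mkseq.
have Pf n : P (f n) by elim/ltn_ind: n => n /fP[].
by exists f; split=> // i j; have [_] := fP j (fun k _ => Pf k); apply.
Qed.

Lemma free_ultrafilter : exists D : set_system nat, UltraFilter D /\
  forall m, D [set n | (m <= n)%N].
Proof.
have [D [UD FD]] := ultraFilterLemma (@eventually_filter); exists D; split=> // m.
by apply: FD; exists m.
Qed.

Section Stability.
Variables (R : realType) (L : signature R) (T : theory L) (x y : ctx L).
Variable phi : formula (x ++ y).

Lemma ecat_utuple (I : Type) (D : set_system I) (UD : UltraFilter D)
    (N : I -> structure L) (Gamma Delta : ctx L)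
    (e : forall i, tup (N i) Gamma) (d : forall i, tup (N i) Delta) :
  mcat (utuple UD e) (utuple UD d) = utuple UD (fun i => mcat (e i) (d i)).
Proof.
elim: Gamma e => [|s G IH] e //; apply: env_eq => -[p|] //.
by have /(congr1 (fun h => h p)) := IH (fun i k => e i (Some k)).
Qed.

(** In an ultraproduct of the given models the classes of the given sequences
    satisfy the limits of all the inequalities that hold from some [n] on.  With
    [K n k] meaning [k <= n], long finite alternations give an infinite one; with
    [K n k] meaning [k <= N], alternations of a fixed length for [eps - 2 ^- n]
    give one for [eps]. *)
Lemma alternation_compactness (eps : R) (K : nat -> nat -> Prop) :
  (forall n, exists (M : structure L) (a : nat -> tup M x) (b : nat -> tup M y),
    models M T /\ forall i j k, (i < j < k)%N -> K n k ->
    eps - 2 ^- n <=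
      `|feval phi (ecat (a j) (b i)) - feval phi (ecat (a j) (b k))|) ->
  exists (M : structure L) (a : nat -> tup M x) (b : nat -> tup M y),
    models M T /\ forall i j k, (i < j < k)%N ->
    (exists n0, forall n, (n0 <= n)%N -> K n k) ->
    eps <= `|feval phi (ecat (a j) (b i)) - feval phi (ecat (a j) (b k))|.
Proof.
move=> /dependent_choice_fun[N NP]; have [a aP] := dependent_choice_fun NP.
have [b H] := dependent_choice_fun aP.
have [D [UD Dge]] := free_ultrafilter.
exists (ultraproduct UD N), (fun i => utuple UD (fun n => a n i)),
  (fun i => utuple UD (fun n => b n i)); split.
  by apply: models_ultraproduct => n; case: (H n).
move=> i j k ijk [n0 n0K]; rewrite !ecat_utuple !Los.
apply/ler_addgt0Pr => e e0; have [n1 n1e] := expr_half_small e0.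
rewrite -lerBlDr; apply: ulim_dist_ge => [n|n|]; try exact: feval01.
apply: filterS (filterI (Dge n0) (Dge n1)) => n [n0n n1n].
have := (H n).2 i j k ijk (n0K n n0n); apply: le_trans.
rewrite lerD2l lerN2; apply: le_trans (ltW n1e).
by rewrite lef_pV2 ?posrE ?exprn_gt0// ler_eXn2l// ltr1n.
Qed.

(** In a stable formula the two iterated limits of [phi (a_i, b_j)] agree; an
    infinite alternation separates them. *)
Lemma no_infinite_alternation (eps : R) (M : structure L) (a : nat -> tup M x)
    (b : nat -> tup M y) : 0 < eps -> stable T phi -> models M T ->
  ~ forall i j k, (i < j < k)%N ->
    eps <= `|feval phi (ecat (a j) (b i)) - feval phi (ecat (a j) (b k))|.
Proof.
move=> eps0 st MT alt; have [D [UD Dge]] := free_ultrafilter.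
pose F i j := feval phi (ecat (a i) (b j)).
have F01 i j : 0 <= F i j <= 1 by exact: feval01.
pose u i := ulim D (fun j => F i j); pose v j := ulim D (fun i => F i j).
have u01 i : 0 <= u i <= 1 by exact: ulim01.
have v01 i : 0 <= v i <= 1 by apply: ulim01 => // j; exact: F01.
have uv : eps <= `|ulim D u - ulim D v|.
  have c01 (i : nat) : 0 <= ulim D u <= 1 by exact: ulim01.
  rewrite -(ulim_cst UD (ulim D u)).
  rewrite distrC; apply: ulim_dist_ge => //; apply: filterE => i.
  apply: ulim_dist_ge => //; apply: filterS (Dge i.+1) => j ij.
  have c'01 (k : nat) : 0 <= F j i <= 1 by [].
  rewrite -(ulim_cst UD (F j i)).
  apply: ulim_dist_ge => //; apply: filterS (Dge j.+1) => k jk.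
  by apply: alt; rewrite ij.
have e80 : 0 < eps / 8 by rewrite divr_gt0.
pose alpha := ulim D u; pose beta := ulim D v.
pose close (c d : R) := `|c - d| < eps / 8.
have close_near (w : nat -> R) : (forall i, 0 <= w i <= 1) ->
  D [set i | close (ulim D w) (w i)] by move=> w01; exact: ulim_near.
(* Indices are chosen one by one, each one generic with respect to the previous
   ones: on the resulting subsequences [F i j] is close to [alpha] and [F j i] to
   [beta] for [i < j]. *)
have [|f [fP fQ]] := @greedy_pairs nat 0%N
    (fun m => close alpha (u m) /\ close beta (v m))
    (fun m n => close (u m) (F m n) /\ close (v m) (F n m)).
  move=> n g gP.
  have : D [set i | forall k : 'I_n, close (u (g k)) (F (g k) i) /\
      close (v (g k)) (F i (g k))].
    elim: n {gP} => [|n IH]; first by apply: filterE => i [].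
    have := ultraI UD (close_near (F (g n)) (F01 _)) (close_near (F^~ (g n)) (F01^~ _)).
    move=> /(ultraI UD IH); apply: filterS => i [Hi Hn] k.
    by have := ltn_ord k; rewrite ltnS leq_eqVlt => /orP[/eqP ->//|kn]; exact: (Hi (Ordinal kn)).
  move=> /(ultraI UD (ultraI UD (close_near u u01) (close_near v v01))) H.
  have [i [[Hu Hv] Hi]] := filter_ex H; exists i; split=> // k kn.
  exact: (Hi (Ordinal kn)).
have e20 : 0 < eps / 2 by rewrite divr_gt0.
apply: (st _ e20); exists M, (a \o f), (b \o f); split=> // i j ij /=.
rewrite -/(F (f i) (f j)) -/(F (f j) (f i)).
have [Hi1 Hi2] := fP i; have [Hij1 Hij2] := fQ i j ij.
move: uv Hi1 Hi2 Hij1 Hij2; rewrite -/alpha -/beta /close !ltr_distlC !ler_normr.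
by case/orP=> uv h1 h2 h3 h4; apply/orP; [left|right]; lra.
Qed.

End Stability.

Section AlternationNumber.
Variables (R : realType) (L : signature R) (T : theory L) (x y : ctx L).
Variable phi : formula (x ++ y).

Definition alternates (M : structure L) (eps : R) (N : nat)
    (a : nat -> tup M x) (b : nat -> tup M y) : Prop :=
  forall i j k, (i < j < k)%N -> (k <= N)%N ->
    eps <= `|feval phi (ecat (a j) (b i)) - feval phi (ecat (a j) (b k))|.

Lemma no_alternationP (eps : R) N : no_alternation T phi eps N <->
  forall M (a : nat -> tup M x) (b : nat -> tup M y), models M T ->
    ~ alternates eps N a b.
Proof.
split=> [H M a b MT ab|H [M [a [b [MT ab]]]]].
  apply: H; exists M, (fun i => a i), (fun i => b i); split=> // i j k ijk.
  by apply: ab => //; rewrite -ltnS.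
apply: (H M (fun i => a (inord i)) (fun i => b (inord i)) MT) => i j k ijk kN.
by apply: ab; rewrite !inordK//; case/andP: ijk => *; lia.
Qed.

Lemma no_alternation_exists (eps : R) : 0 < eps -> stable T phi ->
  exists N, no_alternation T phi eps N.
Proof.
move=> eps0 st; apply: contrapT => /forallNP H.
have [n|M [a [b [MT ab]]]] := @alternation_compactness R L T x y phi eps (fun n k => k <= n)%N.
  have : ~ forall M (a : nat -> tup M x) (b : nat -> tup M y), models M T ->
    ~ alternates eps n a b by move=> /no_alternationP; exact: H.
  apply: contra_notP => nex M a b MT ab; apply: nex; exists M, a, b; split=> // i j k ijk kn.
  by apply: le_trans (ab i j k ijk kn); rewrite gerBl ltW// expr_half_gt0.
apply: (no_infinite_alternation eps0 st MT (a := a) (b := b)) => i j k ijk.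
by apply: ab => //; exists k.
Qed.

Lemma no_alternation_Nalt (eps : R) : 0 < eps -> stable T phi ->
  no_alternation T phi eps (Nalt T phi eps).
Proof.
move=> eps0 st; have [N0 HN0] := no_alternation_exists eps0 st.
have ex : exists N, `[< no_alternation T phi eps N >] by exists N0; apply/asboolP.
have [N /asboolP NP Nmin] := ex_minnP ex.
rewrite /Nalt; case: xgetP => [m -> []//|/(_ N)[]]; split=> // N' N'P.
by apply: Nmin; apply/asboolP.
Qed.

(** If there were alternations of this length for every [eps1 < eps], their limit
    in an ultraproduct would be one for [eps].  The gap between [eps1] and [eps] is
    what the approximation by medians consumes. *)
Lemma no_alternation_slack (eps : R) N : 0 < eps -> no_alternation T phi eps N ->
  exists eps1, 0 < eps1 < eps /\ no_alternation T phi eps1 N.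
Proof.
move=> eps0 HN; apply: contrapT => /forallNP H.
have [n|M [a [b [MT ab]]]] := @alternation_compactness R L T x y phi eps (fun n k => k <= N)%N.
  have e0 : 0 < eps - Num.min (2 ^- n) (eps / 2).
    by rewrite subr_gt0 gt_min orbC ltr_pdivrMr// ltr_pMr// ltr1n.
  have e1 : eps - Num.min (2 ^- n) (eps / 2) < eps.
    by rewrite gtrBl lt_min expr_half_gt0 divr_gt0.
  have : ~ forall M (a : nat -> tup M x) (b : nat -> tup M y), models M T ->
      ~ alternates (eps - Num.min (2 ^- n) (eps / 2)) N a b.
    by move=> /no_alternationP HN'; have := H (eps - Num.min (2 ^- n) (eps / 2)); rewrite e0 e1; apply.
  apply: contra_notP => nex M a b MT ab; apply: nex; exists M, a, b; split=> // i j k ijk kn.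
  by apply: le_trans (ab i j k ijk kn); rewrite lerD2l lerN2 ge_min lexx.
move/no_alternationP: HN => HN; apply: (HN M a b MT).
by move=> i j k ijk kN; apply: ab => //; exists 0%N.
Qed.

Lemma Nalt_gt0 (M : structure L) (eps : R) : models M T -> 0 < eps -> stable T phi ->
  (0 < Nalt T phi eps)%N.
Proof.
move=> MT eps0 st; have := no_alternation_Nalt eps0 st.
have [a] := tup_inh M x; have [b] := tup_inh M y.
move=> /no_alternationP H; rewrite lt0n; apply/eqP => N0.
apply: (H M (fun=> a) (fun=> b) MT) => i j k; rewrite N0.
by move=> /andP[_ jk]; rewrite leqn0 => /eqP k0; rewrite k0 in jk.
Qed.

End AlternationNumber.

Section Median.
Variable R : realType.

(** A majority of the entries lies in the interval, so the entries below it, and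
    those above it, are fewer than [N] and cannot reach the middle. *)
Lemma median_between (s : seq R) (l u : R) N : size s = (2 * N - 1)%N -> (0 < N)%N ->
  (N <= count (fun v => (l <= v <= u)%R) s)%N -> l <= median s <= u.
Proof.
move=> sN N0 cN; rewrite /median; set t := sort _ s.
have tN : size t = (2 * N - 1)%N by rewrite size_sort.
have tc (P : pred R) : count P t = count P s by apply/permP; rewrite perm_sort.
have ts : sorted <=%R t by apply: sort_sorted; exact: le_total.
have -> : (size s)./2 = N.-1 by rewrite sN; lia.
have good (P : pred R) : (forall v, P v -> ~~ (l <= v <= u)) -> (count P t < N)%N.
  move=> PN; have : (count P t + count (fun v => (l <= v <= u)%R) t <= size t)%N.
    rewrite -count_predUI.
    have /eq_count -> : predI P (fun v => (l <= v <= u)%R) =1 pred0.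
      by move=> v /=; apply/negbTE/negP => /andP[/PN/negP].
    by rewrite count_pred0 addn0 count_size.
  by move: cN; rewrite tN -tc => h1 h2; rewrite ltnNge; apply/negP => h3;
  have := leq_trans (leq_add h3 h1) h2; lia.
apply/andP; split; rewrite leNgt; apply/negP => h.
  have : (N <= count (fun v => v < l)%R t)%N.
    rewrite -(cat_take_drop N t) count_cat; apply: leq_trans (leq_addr _ _).
    have -> : count (fun v => v < l) (take N t) = size (take N t).
      apply/eqP; rewrite -all_count; apply/(all_nthP 0) => i.
      rewrite size_take tN => iN; have {}iN : (i < N)%N by move: iN; case: ifP; lia.
      rewrite nth_take//; apply: le_lt_trans h.
      apply: (sorted_leq_nth le_trans le_refl 0 ts); rewrite ?inE ?tN; lia.
    by rewrite size_take tN; case: ifP; lia.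
  apply/negP; rewrite -ltnNge; apply: good => v; rewrite ltNge => /negP vl.
  by apply/negP => /andP[].
have : (N <= count (fun v => u < v)%R t)%N.
  rewrite -(cat_take_drop N.-1 t) count_cat; apply: leq_trans (leq_addl _ _).
  have -> : count (fun v => u < v) (drop N.-1 t) = size (drop N.-1 t).
    apply/eqP; rewrite -all_count; apply/(all_nthP 0) => i.
    rewrite size_drop tN => iN; rewrite nth_drop; apply: lt_le_trans h _.
    apply: (sorted_leq_nth le_trans le_refl 0 ts); rewrite ?inE ?tN; lia.
  by rewrite size_drop tN; lia.
apply/negP; rewrite -ltnNge; apply: good => v; rewrite ltNge => /negP vl.
by apply/negP => /andP[].
Qed.

(** The successive corrections of [flim] may move the approximation by [2 ^- n.+1]
    at step [n.+1], which is what is needed to repair an error of [2 ^- n]. *)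
Lemma flim_approx (u : nat -> R) (a : R) : (forall n, `|u n - a| <= 2 ^- n) -> flim u = a.
Proof.
move=> ua; apply: (cvg_lim (@Rhausdorff R)).
have H n : `|slowed u n - a| <= 2 ^- n.
  elim: n => [|n IH]; first exact: ua.
  have := ua n.+1; move: IH; rewrite [slowed u n.+1]/= expr_halfS.
  have := expr_half_gt0 R n; set c := 2 ^- n; rewrite !ler_distlC.
  by rewrite minEle; case: ifP => ?; rewrite maxEle; case: ifP => ?; lra.
apply/cvgrPdist_lt => e e0; have [n ne] := expr_half_small e0; exists n => // m /= nm.
rewrite distrC; apply: le_lt_trans (H m) _; apply: le_lt_trans ne.
by rewrite lef_pV2 ?posrE ?exprn_gt0// ler_eXn2l// ltr1n.
Qed.

Variable Y : Type.
Implicit Types (F : set (Y -> R)) (f q : Y -> R).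

Definition alternating F (eps : R) (N : nat) : Prop :=
  exists (f : nat -> Y -> R) (b : nat -> Y), (forall n, F (f n)) /\
  forall i j k, (i < j < k)%N -> (k <= N)%N -> eps <= `|f j (b i) - f j (b k)|.

Definition adherent F q : Prop :=
  exists D : set_system (Y -> R), [/\ UltraFilter D, D F
    & forall b e, 0 < e -> D [set f | `|f b - q b| < e]].

End Median.

(** * Approximation by medians *)

Section MedianApproximation.
Variables (R : realType) (Y : Type).
Implicit Types (F : set (Y -> R)) (f q : Y -> R).

(** The functions [g n] are chosen one after the other, close to [q] at test
    points.  For each set [W] of earlier functions and each approximate value of
    [q], a test point is one at which all of [W] is far from [q] and [q] has this
    value, if there is one.  If [N] of the functions were far from [q] at some
    point, the test points of the initial segments of these functions would
    alternate with them; so at each point most of the [2 * N - 1] functions are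
    close to [q], hence so is their median. *)
Lemma median_approximation F q (eps1 eps : R) N :
  eps1 < eps -> (0 < N)%N -> ~ alternating F eps1 N -> adherent F q ->
  (forall b, 0 <= q b <= 1) ->
  exists g : nat -> Y -> R, (forall n, F (g n)) /\
    forall b, `|q b - median [seq g i b | i <- iota 0 (2 * N - 1)]| <= eps.
Proof.
move=> eps1eps N0 nalt [D [UD DF Dq]] q01.
have [f0 Ff0] := filter_ex DF.
have [[b0]|noY] := pselect (inhabited Y); last first.
  by exists (fun=> f0); split=> // b; case: noY; exact: inhabits.
have [d d0 dE] : exists2 d : R, 0 < d & d = (eps - eps1) / 2.
  by exists ((eps - eps1) / 2); rewrite // divr_gt0// subr_gt0.
(* On the points of one colour [q] is almost constant; there are finitely many
   colours, as [q] is bounded. *)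
pose color b := Num.truncn (q b / d).
have colorP b : (color b)%:R <= q b / d < (color b).+1%:R.
  by apply: truncn_itv; apply: divr_ge0 (ltW d0); case/andP: (q01 b).
have same_color b b' : color b = color b' -> `|q b - q b'| <= d.
  have := colorP b; have := colorP b'.
  rewrite !ler_pdivlMr// !ltr_pdivrMr// => h' h e; move: h h'.
  by rewrite e -natr1 mulrDl mul1r ler_distlC; lra.
pose G := Num.truncn d^-1.
have colorG b : (color b <= G)%N.
  by apply: le_truncn; rewrite ler_pdivrMr// mulVf ?gt_eqF//; case/andP: (q01 b).
pose test (W : set (Y -> R)) (r : nat) (b : Y) :=
  color b = r /\ forall f, W f -> eps < `|f b - q b|.
have [bsel bselP] : exists bsel : set (Y -> R) -> nat -> Y,
    forall W r b, test W r b -> test W r (bsel W r).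
  have /choice[h hP] (Wr : set (Y -> R) * nat) : exists b,
      forall b', test Wr.1 Wr.2 b' -> test Wr.1 Wr.2 b.
    have [[b' bP]|no] := pselect (exists b, test Wr.1 Wr.2 b); first by exists b'.
    by exists b0 => b' b'P; case: no; exists b'.
  by exists (fun W r => h (W, r)) => W r b /(hP (W, r)).
pose pick (s : seq (Y -> R)) (P : pred nat) : set (Y -> R) :=
  [set nth f0 s i | i in [set i | (i < size s)%N /\ P i]].
have [s|g gP] := @greedy_sequence (Y -> R) (fun s f => F f /\
    forall (P : pred nat) r, (r <= G)%N ->
      `|f (bsel (pick s P) r) - q (bsel (pick s P) r)| < d).
  pose ext (J : {ffun 'I_(size s) -> bool}) : pred nat :=
    fun i => if insub i is Some k then J k else false.
  have H : D [set f | forall Jr : {ffun 'I_(size s) -> bool} * 'I_G.+1,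
      `|f (bsel (pick s (ext Jr.1)) Jr.2) - q (bsel (pick s (ext Jr.1)) Jr.2)| < d].
    by apply: filter_forall => Jr; exact: Dq.
  have [f [Ff fq]] := filter_ex (ultraI UD DF H); exists f; split=> // P r rG.
  have rG' : (r < G.+1)%N by [].
  have := fq ([ffun k : 'I_(size s) => P k], Ordinal rG').
  rewrite (_ : pick s (ext _) = pick s P)//; congr image; apply/seteqP; split=> i /= [iS].
    by rewrite /ext insubT/= ffunE.
  by move=> Pi; split=> //; rewrite /ext insubT/= ffunE.
have Fg n : F (g n) by case: (gP n).
pose W n (P : pred nat) := [set g i | i in [set i | (i < n)%N /\ P i]].
have {}gP n (P : pred nat) r : (r <= G)%N ->
    `|g n (bsel (W n P) r) - q (bsel (W n P) r)| < d.
  have [_ H] := gP n; move=> /(H P); rewrite (_ : pick _ _ = W n P)//.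
  apply/seteqP; rewrite /pick size_mkseq; split=> _ [i [iN Pi] <-]; exists i => //;
    by rewrite nth_mkseq.
exists g; split=> // b.
pose bad : pred nat := fun i => eps < `|g i b - q b|.
set M := (2 * N - 1)%N.
have [few|many] := ltnP (count bad (iota 0 M)) N.
  rewrite ler_distlC; apply: (@median_between _ _ _ _ N) => //.
    by rewrite size_map size_iota.
  rewrite count_map; have := count_predC bad (iota 0 M); rewrite size_iota => E.
  have /eq_count -> : (preim (g^~ b) (fun v => q b - eps <= v <= q b + eps)) =1 predC bad.
    by move=> i /=; rewrite /bad -leNgt distrC ler_distlC.
  by move: E few N0; rewrite /M; lia.
(* [u] enumerates the functions that are far from [q] at [b]; the [k]-th test point
   is made for those among the first [t k] functions, and the [j]-th member of the
   alternation is the one that precedes the [j]-th test point. *)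
case: nalt; pose u := [seq i <- iota 0 M | bad i].
have su : (N <= size u)%N by rewrite size_filter.
have usort : sorted ltn u by apply: sorted_filter; [exact: ltn_trans|exact: iota_ltn_sorted].
have uP k : (k < N)%N -> (nth 0%N u k < M)%N /\ bad (nth 0%N u k).
  move=> kN; have : nth 0%N u k \in u by rewrite mem_nth// (leq_trans kN).
  by rewrite mem_filter mem_iota /= => /andP[].
pose t k := if (k < N)%N then nth 0%N u k else M.
have {}bselP n : color (bsel (W n bad) (color b)) = color b /\
    forall i, (i < n)%N -> bad i ->
      eps < `|g i (bsel (W n bad) (color b)) - q (bsel (W n bad) (color b))|.
  have [|-> H] := bselP (W n bad) (color b) b; first by split=> // _ [i [_ badi] <-].
  by split=> // i iN badi; apply: H; exists i.
exists (fun j => g (nth 0%N u j.-1)), (fun k => bsel (W (t k) bad) (color b)).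
split=> [n|i j k /andP[ij jk] kN]; first exact: Fg.
have j1N : (j.-1 < N)%N by lia.
have ultn i' j' : (i' < j')%N -> (j' < N)%N -> (nth 0%N u i' < nth 0%N u j')%N.
  move=> ij' jN'; apply: (sorted_ltn_nth ltn_trans 0%N usort); rewrite ?inE; lia.
have [Uj badj] := uP _ j1N.
have ti : (t i <= nth 0%N u j.-1)%N.
  rewrite /t (_ : (i < N)%N = true); last by lia.
  have [->//|ne] := eqVneq i j.-1; apply/ltnW/ultn => //; lia.
have tk : (nth 0%N u j.-1 < t k)%N.
  have [kN'|kN'] := ltnP k N; rewrite /t.
    by rewrite kN'; apply: ultn => //; lia.
  by rewrite (ltnNge k) kN'.
have close := gP (nth 0%N u j.-1) (fun m => bad m && (m < t i)%N) (color b) (colorG b).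
rewrite (_ : W _ (fun m => bad m && (m < t i)%N) = W (t i) bad) in close; last first.
  apply/seteqP; split=> _ [m [mu Pm] <-]; exists m => //.
    by split; case/andP: Pm.
  by split; [exact: leq_trans mu ti|apply/andP].
have [ci _] := bselP (t i); have [ck /(_ _ tk badj) far] := bselP (t k).
have := same_color _ _ (etrans ci (esym ck)); move: close far.
set bi := bsel _ _; set bk := bsel (W (t k) bad) _.
rewrite ler_distlC ltr_distlC => h1 h2 h3.
move: h2; rewrite dE in h1 h3; rewrite ltNge ler_distlC => /negP h2.
by rewrite leNgt ltr_distlC; apply/negP => h4; apply: h2; lra.
Qed.

End MedianApproximation.

(** At stage [n] the [2 * N - 1] arguments of [dphi] are those of a median within
    [2 ^- n] of [q], where [N] is the alternation number for [2 ^- n] itself: this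
    is possible because [N] also bounds the alternations for some smaller
    [eps1]. *)
Lemma dphi_adherent (R : realType) (L : signature R) (T : theory L) (x y : ctx L)
    (phi : formula (x ++ y)) (M : structure L) (q : tup M y -> R) :
  stable T phi -> models M T -> (forall b, 0 <= q b <= 1) ->
  adherent [set f | exists a : tup M x, f = fun b => feval phi (ecat a b)] q ->
  exists C : dfamily T phi M, forall b, dphi C b = q b.
Proof.
move=> st MT q01 qa.
have H n : exists C : 'I_(dwidth T phi n) -> tup M x, forall b,
    `|median [seq feval phi (ecat (C i) b) | i : 'I_(dwidth T phi n)] - q b| <= 2 ^- n.
  have e0 := expr_half_gt0 R n.
  have [eps1 [/andP[eps10 eps1n] HN]] :=
    no_alternation_slack e0 (no_alternation_Nalt e0 st).
  have [|g [gP gq]] := median_approximation eps1n (Nalt_gt0 MT e0 st) _ qa q01.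
    move=> [f [b [fP fb]]]; move/no_alternationP: HN => HN.
    have [a aP] := dependent_choice_fun fP.
    by apply: (HN M a b MT) => i j k ijk kN; have := fb i j k ijk kN; rewrite aP.
  have [a aP] := dependent_choice_fun gP.
  exists (fun i => a i) => b; rewrite distrC; move: (gq b); congr (`|_ - median _| <= _).
  rewrite /image_mem -val_enum_ord -map_comp; apply: eq_map => i /=.
  by rewrite aP.
have [C CP] := dependent_choice_fun H.
by exists C => b; apply: flim_approx => n; exact: CP.
Qed.

(** * Fragmentation *)

Lemma no_injection_cantor (c : (nat -> bool) -> nat) : exists u v, u <> v /\ c u = c v.
Proof.
apply: contrapT => H.
have inj u v : c u = c v -> u = v.
  by move=> cuv; apply: contrapT => uv; apply: H; exists u, v.
have /choice[g gP] n : exists u, forall v, c v = n -> u = v.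
  have [[v vn]|no] := pselect (exists v, c v = n).
    by exists v => w wn; apply: inj; rewrite vn.
  by exists (fun=> true) => v vn; case: no; exists v.
pose d n := ~~ g n n.
have /(congr1 (fun f => f (c d))) := gP (c d) d erefl.
by move=> /= e; have : d (c d) = ~~ g (c d) (c d) by []; rewrite e; case: (d _).
Qed.

Section Fragmentation.
Variables (R : realType) (Y : Type).
Implicit Types (F : set (Y -> R)) (f q z : Y -> R).

(** If every relatively open part of [F] had two members further apart than
    [eps], one could grow a binary tree of members of [F] in which the two
    successors of a node disagree at some point by [eps] while members further up a
    branch almost agree at this point; then limits along different branches
    differ.  But a limit along a branch is, up to [eps / 4], the median of
    finitely many nodes of the branch, and there are only countably many finite
    families of nodes. *)
Lemma fragmentation F (eps : R) N : 0 < eps -> F !=set0 -> (0 < N)%N ->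
  (forall f b, F f -> 0 <= f b <= 1) -> ~ alternating F (eps / 8) N ->
  exists z (l : seq Y) (d : R), [/\ F z, 0 < d &
    forall f f', F f -> F f' -> all (fun b => `|f b - z b| < d) l ->
      all (fun b => `|f' b - z b| < d) l -> forall b, `|f b - f' b| <= eps].
Proof.
move=> eps0 [z0 Fz0] N0 F01 nalt; apply: contrapT => H.
have /dependent_choice_fun[split splitP] : forall w : (Y -> R) * seq Y * R,
    exists s : (Y -> R) * (Y -> R) * Y, F w.1.1 -> 0 < w.2 ->
    [/\ F s.1.1, F s.1.2, all (fun b => `|s.1.1 b - w.1.1 b| < w.2) w.1.2,
      all (fun b => `|s.1.2 b - w.1.1 b| < w.2) w.1.2 & eps < `|s.1.1 s.2 - s.1.2 s.2|].
  move=> [[z l] d] /=; have [[Fz d0]|no] := pselect (F z /\ 0 < d); last first.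
    have [b0] : exists b : Y, True.
      apply: contrapT => noY; apply: H; exists z0, [::], 1; split=> // f f' _ _ _ _ b.
      by case: noY; exists b.
    by move=> _; exists (z0, z0, b0) => Fz d0; case: no.
  apply: contrapT => nos; apply: H; exists z, l, d; split=> // f f' Ff Ff' fl f'l b.
  rewrite leNgt; apply/negP => ff'; apply: nos; exists (f, f', b); split=> //.
(* The tolerances along a branch add up to [eps / 8]. *)
pose del n : R := eps / 16 * 2 ^- n.
have del0 n : 0 < del n by rewrite mulr_gt0 ?divr_gt0 ?expr_half_gt0.
(* A node is named by the sequence of choices leading to it, the last one first;
   it consists of a member of [F] and of the points at which its ancestors split. *)
pose node := fix node (s : seq bool) : (Y -> R) * seq Y :=
  if s is c :: s' then
    let w := (node s', del (size s')) in
    (if c then (split w).1.1 else (split w).1.2, (split w).2 :: (node s').2)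
  else (z0, [::]).
pose w s := (node s, del (size s)).
have Fnode s : F (node s).1.
  elim: s => [//|c s IH] /=; have [H1 H2 _ _ _] := splitP (w s) IH (del0 _).
  by case: c.
have step c s : all (fun b => `|(node (c :: s)).1 b - (node s).1 b| < del (size s)) (node s).2.
  have [_ _ H1 H2 _] := splitP (w s) (Fnode s) (del0 _).
  by case: c.
pose pre (u : nat -> bool) := fix pre n := if n is m.+1 then u m :: pre m else [::].
have size_pre u n : size (pre u n) = n by elim: n => //= n ->.
have pre_sub u n k b : List.In b (node (pre u n)).2 -> List.In b (node (pre u (k + n)%N)).2.
  by elim: k => // k IH /IH h /=; right.
have allIn (P : pred Y) (l : seq Y) b : all P l -> List.In b l -> P b.
  by elim: l => //= c l IH /andP[Pc /IH Pl] [<-|/Pl].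
have near_branch u n k b : List.In b (node (pre u n)).2 ->
    `|(node (pre u (k + n)%N)).1 b - (node (pre u n)).1 b| <= eps / 8 - eps / 8 * 2 ^- k.
  move=> bl; suff : `|(node (pre u (k + n)%N)).1 b - (node (pre u n)).1 b| <=
      eps / 8 * (2 ^- n - 2 ^- (k + n)).
    move/le_trans; apply; have h1 := expr_half_gt0 R n; have h2 := expr_half_gt0 R k.
    rewrite (_ : 2 ^- (k + n) = 2 ^- k * 2 ^- n :> R); last by rewrite exprD invfM.
    have n1 : 2 ^- n <= 1 :> R by rewrite invf_le1 ?exprn_gt0// exprn_ege1// ler1n.
    have k1 : 2 ^- k <= 1 :> R by rewrite invf_le1 ?exprn_gt0// exprn_ege1// ler1n.
    rewrite -{2}[eps / 8]mulr1 -mulrBr ler_pM2l ?divr_gt0//.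
    have : 0 <= (1 - 2 ^- n) * (1 - 2 ^- k) :> R by rewrite mulr_ge0// subr_ge0.
    by move: (2 ^- n) (2 ^- k) => p p'; lra.
  elim: k => [|k IH]; first by rewrite !subrr normr0 mulr0.
  have := allIn _ _ _ (step (u (k + n)%N) (pre u (k + n)%N)) (pre_sub u n k b bl).
  rewrite size_pre /del addSn expr_halfS.
  have -> : u (k + n)%N :: pre u (k + n)%N = pre u (k + n).+1 by [].
  by move: IH; rewrite ler_distlC ltr_distlC ler_distlC; lra.
have [D [UD Dge]] := free_ultrafilter.
pose lim_ u b := ulim D (fun n => (node (pre u n)).1 b).
have lim01 u b : 0 <= lim_ u b <= 1 by apply: ulim01 => // n; exact: F01.
have lim_near u n b : List.In b (node (pre u n)).2 ->
    `|lim_ u b - (node (pre u n)).1 b| <= eps / 8.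
  move=> bl; rewrite -(ulim_cst UD ((node (pre u n)).1 b)).
  apply: ulim_dist_le => [m|m|]; try exact: F01.
  apply: filterS (Dge n) => m /= nm; have := near_branch u n (m - n)%N b bl.
  rewrite subnK// => /le_trans; apply; rewrite gerBl.
  by rewrite mulr_ge0 ?divr_ge0 ?ltW ?expr_half_gt0.
have sep u v : u <> v -> exists b, 3 / 4 * eps < `|lim_ u b - lim_ v b|.
  move=> uv; have ex : exists n, u n != v n.
    by apply: contrapT => no; apply: uv; apply: funext => n; apply/eqP/negP => nn; apply: no; exists n; apply/negP.
  have [n uvn nmin] := ex_minnP ex.
  have preE : pre u n = pre v n.
    have : forall m, (m <= n)%N -> pre u m = pre v m.
      elim=> //= m IH mn; rewrite IH ?(ltnW mn)//; congr cons; apply/eqP.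
      by apply: contraTT mn => /nmin; rewrite -leqNgt.
    exact.
  pose b := (split (w (pre u n))).2; exists b.
  have [_ _ _ _ far] := splitP (w (pre u n)) (Fnode _) (del0 _).
  have hu : `|lim_ u b - (node (pre u n.+1)).1 b| <= eps / 8 by apply: lim_near; left.
  have hv : `|lim_ v b - (node (pre v n.+1)).1 b| <= eps / 8.
    by apply: lim_near; left; rewrite -preE.
  move: hu hv far; rewrite /= -preE -/(w (pre u n)) -/b.
  move: uvn; case: (u n); case: (v n) => // _; rewrite !ler_distlC ltNge => h1 h2 /negP h3;
    rewrite ltNge; apply/negP; rewrite ler_distlC => h4; apply: h3; rewrite ler_distlC; lra.
have code u : exists t : seq nat, forall b,
    `|lim_ u b - median [seq (node (pre u k)).1 b | k <- t]| <= eps / 4.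
  have [|||||g [gP gm]] := @median_approximation R Y [set (node (pre u n)).1 | n in [set: nat]]
      (lim_ u) (eps / 8) (eps / 4) N.
  - lra.
  - by [].
  - move=> [f [b [fP fb]]]; apply: nalt; exists f, b; split=> // n.
    by have [m _ <-] := fP n.
  - exists ((fun n => (node (pre u n)).1) @ D); split; first exact: ultrafilter_map.
      by apply: (@filterE _ D) => n; exists n.
    move=> b e e0; have := ulim_near UD (u := fun n => (node (pre u n)).1 b) _ e0.
    by move=> /(_ (fun n => F01 _ _ (Fnode _))); apply: filterS => n; rewrite /= distrC.
  - exact: lim01.
  have [k kP] : exists k : nat -> nat, forall i, g i = (node (pre u (k i))).1.
    have /choice[k kP] i : exists n, g i = (node (pre u n)).1 by have [n _ <-] := gP i; exists n.
    by exists k.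
  exists (map k (iota 0 (2 * N - 1))) => b; move: (gm b); rewrite -map_comp.
  by congr (`|_ - median _| <= _); apply: eq_map => i; rewrite /= kP.
have /choice[t tP] := code.
have [u [v [uv]]] := no_injection_cantor (fun u => pickle [seq pre u k | k <- t u]).
move=> /(pcan_inj pickleK) E; have [b] := sep _ _ uv.
have Em : [seq (node (pre u k)).1 b | k <- t u] = [seq (node (pre v k)).1 b | k <- t v].
  by have := congr1 (map (fun s => (node s).1 b)) E; rewrite -!map_comp.
have := tP u b; have := tP v b; rewrite -Em.
by rewrite !ler_distlC ltNge => h1 h2 /negP; apply; rewrite ler_distlC; lra.
Qed.

End Fragmentation.

(** * The monster model *)

Section Monster.
Variables (R : realType) (L : signature R).
Implicit Types (M N U : structure L).

(** The limit is realised in the ultraproduct of the structures which realise the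
    given types, a diagonal elementary extension of [M]. *)
Lemma type_limit (I : Type) (D : set_system I) (UD : UltraFilter D) M (B : pset M)
    (x : ctx L) (r : I -> ctype B x) :
  exists r' : ctype B x, forall psi, tvalue r' psi = ulim D (fun i => tvalue (r i) psi).
Proof.
have /dependent_choice_fun[N NP] : forall i, is_type (tvalue (r i)).
  by move=> i; exact: (svalP (r i : ctype_ B x)).
have [h hP] := dependent_choice_fun NP; have [a aP] := dependent_choice_fun hP.
have isr : is_type (pvalue (diagonal UD h) (utuple UD a) : pformula B x -> R).
  by exists (ultraproduct UD N), (diagonal UD h), (utuple UD a).
exists (exist _ _ isr : ctype_ B x) => psi.
rewrite {1}/tvalue /= /pvalue.
rewrite (_ : mmap (diagonal UD h) (ppar psi) = utuple UD (fun i => mmap (h i) (ppar psi)))//.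
rewrite ecat_utuple Los; congr ulim; apply: funext => i.
by rewrite aP.
Qed.

Lemma saturated_limit (K : Type) U (B : pset U) (x : ctx L) (I : Type) (D : set_system I)
    (r : I -> tup U x) : saturated K U -> small K B -> UltraFilter D ->
  exists a : tup U x, forall psi : pformula B x,
    pvalue (eemb_id U) a psi = ulim D (fun i => pvalue (eemb_id U) (r i) psi).
Proof.
move=> satU smB UD; have [r' r'P] := type_limit UD (fun i => tp B (r i)).
have [a aP] := satU B smB x r'; exists a => psi.
by have := r'P psi; rewrite -aP.
Qed.

(** * Small sets *)

Lemma inj_image_card_le (T T' : Type) (f : T -> T') (A : set T) (B : set T') :
  {in A &, injective f} -> f @` A `<=` B -> (A #<= B)%card.
Proof.
move=> fI fAB; have := inj_card_eq fI; rewrite card_eq_sym card_eq_le => /andP[AfA _].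
exact: card_le_trans AfA (subset_card_le fAB).
Qed.

(** The added point is absorbed by shifting a sequence of distinct elements. *)
Lemma card_le_setU1 (T : Type) (X : set T) (c : T) : infinite_set X ->
  (X `|` [set c] #<= X)%card.
Proof.
move=> Xinf; have [Xc|Xc] := pselect (X c).
  by apply: subset_card_le => z [//|->].
have [|f [fX fI]] := @greedy_pairs T c X (fun a b => b <> a).
  move=> n g gX; apply: contrapT => no; apply: Xinf.
  apply: (sub_finite_set _ (finite_image g (finite_II n))) => z Xz.
  apply: contrapT => zg; apply: no; exists z; split=> // i i_n zgi.
  by apply: zg; exists i.
have {}fI i j : f i = f j -> i = j.
  move=> fij; have [ij|ji|//] := ltngtP i j.
    by have := fI _ _ ij; rewrite fij.
  by have := fI _ _ ji; rewrite fij.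
have fc i : f i <> c by move=> fic; apply: Xc; rewrite -fic.
have /choice[h hP] z : exists z', [/\ z = c -> z' = f 0%N,
    forall i, z = f i -> z' = f i.+1 & z <> c -> (forall i, z <> f i) -> z' = z].
  have [zc|zc] := pselect (z = c).
    by exists (f 0%N); split=> // i; rewrite zc => /esym/fc.
  have [[i zi]|no] := pselect (exists i, z = f i).
    exists (f i.+1); split=> // [k|_ /(_ i)//]; rewrite zi => /fI <-//.
  by exists z; split=> // i zi; case: no; exists i.
have hcase z : (z = c /\ h z = f 0%N) \/ (exists i, z = f i /\ h z = f i.+1) \/
    (h z = z /\ forall i, z <> f i).
  have [h1 h2 h3] := hP z; have [zc|zc] := pselect (z = c); first by left; auto.
  have [[i zi]|no] := pselect (exists i, z = f i); first by right; left; exists i; auto.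
  have nf i : z <> f i by move=> zi; apply: no; exists i.
  by right; right; auto.
apply: (@inj_image_card_le _ _ h).
  move=> z z' _ _ hh; case: (hcase z) => [[zc hz]|[[i [zi hz]]|[hz zf]]];
    case: (hcase z') => [[zc' hz']|[[k [zk hz']]|[hz' zf']]]; rewrite hz hz' in hh.
  - by rewrite zc.
  - by have := fI _ _ hh.
  - by case: (zf' 0%N).
  - by have := fI _ _ hh.
  - by rewrite zi zk; have [->] := fI _ _ hh.
  - by case: (zf' i.+1).
  - by case: (zf 0%N).
  - by case: (zf k.+1).
  - exact: hh.
move=> _ [z Xz <-]; case: (hcase z) => [[_ ->]|[[i [_ ->]]|[hz _]]]; try exact: fX.
case: Xz => [|/= zc]; first by rewrite hz.
by have [/(_ zc) -> _ _] := hP z; exact: fX.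
Qed.

Lemma card_lt_setU1 (T K : Type) (X : set T) (c : T) :
  infinite_set [set: K] -> card_lt X [set: K] -> card_lt (X `|` [set c]) [set: K].
Proof.
move=> Kinf [XK KX]; have [Xfin|Xinf] := pselect (finite_set X); last first.
  split; first exact: card_le_trans (card_le_setU1 c Xinf) XK.
  by move=> KXc; apply: KX; exact: card_le_trans KXc (card_le_setU1 c Xinf).
have fin : finite_set (X `|` [set c]) by rewrite finite_setU.
split; last by move=> /card_le_finite/(_ fin).
have [n] := fin; rewrite card_eq_le => /andP[Xn _]; apply: card_le_trans Xn _.
by apply: card_le_trans (card_leT _) _; exact/infiniteP.
Qed.

Lemma language_lt_infinite (K : Type) : language_lt L K -> infinite_set [set: K].
Proof.
move=> [LK _]; apply/infiniteP; apply: card_le_trans LK.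
by apply: (@inj_image_card_le _ _ (fun n => inl (inl (inl n)))) => // m n _ _ [].
Qed.

Definition padd U (B : pset U) (s : sorts L) (c : U s) : pset U :=
  fun s' b => B s' b \/ existT (fun t => U t : Type) s' b = existT _ s c.

Lemma small_padd (K : Type) U (B : pset U) (s : sorts L) (c : U s) :
  infinite_set [set: K] -> small K B -> small K (padd B c).
Proof.
move=> Kinf /(card_lt_setU1 (existT (fun t => U t : Type) s c) Kinf).
rewrite /small; congr card_lt; apply/seteqP; split=> -[s' b] /=.
  by case=> [?|?]; [left|right].
by case=> [?|?]; [left|right].
Qed.

Lemma small_sub (K : Type) U (A B : pset U) : psub A B -> small K B -> small K A.
Proof.
move=> AB [BK KB]; have AB' : [set a : {s & U s} | A (projT1 a) (projT2 a)] `<=`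
    [set a : {s & U s} | B (projT1 a) (projT2 a)] by move=> a; exact: AB.
split; first exact: card_le_trans (subset_card_le AB') BK.
by move=> KA; apply: KB; apply: card_le_trans KA (subset_card_le AB').
Qed.

(** * Homogeneity *)

Lemma existT_inj (S : Type) (N : S -> Type) s (a b : N s) :
  existT N s a = existT N s b -> a = b.
Proof.
move=> e; have := projT2_eq e.
by rewrite (Prop_irrelevance (projT1_eq e) erefl).
Qed.

Lemma pset_existT U (B : pset U) (s t : sorts L) (b : U t) (c : U s) :
  existT (fun t => U t : Type) t b = existT _ s c -> B t b -> B s c.
Proof.
move=> e Bb; have : (fun a : {t & U t} => B (projT1 a) (projT2 a)) (existT _ t b) by [].
by rewrite e.
Qed.

Definition identity_automorphism U : automorphism U :=
  @Automorphism R L U (fun s => id) (fun s => Bijective (fun=> erefl) (fun=> erefl))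
    (fun _ _ _ _ => erefl) (fun _ _ _ => erefl).

Section Conjugation.
Variables (U : structure L) (A : pset U) (s : sorts L) (c c' : U s).
Hypothesis cc' : tp A (@esingle _ (carrier U) s c') = tp A (@esingle _ (carrier U) s c).

Lemma tp_feval (Delta : ctx L) (f : formula (s :: Delta)) (d : tup U Delta) :
  inp A d -> feval f (mcons c' d) = feval f (mcons c d).
Proof.
by move=> Ad; have := congr1 (fun p => tvalue p (@PFormula R L U A [:: s] Delta f d Ad)) cc'.
Qed.

(** The distance to [c'] is then a formula with parameter in [A]. *)
Lemma tp_eq_in : @A s c' -> c = c'.
Proof.
move=> Ac'.
have th0 : term [:: s; s] s := @tvar R L [:: s; s] None.
pose th : forall i : pos [:: s; s], term [:: s; s] (sortat i) := @tvar R L [:: s; s].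
have Ad : inp A (@esingle _ (carrier U) s c') by move=> -[[]|].
have := tp_feval (fatom (dsym s) th) Ad; rewrite /=.
have E (u : U s) : (fun i => teval (mcons u (@esingle _ (carrier U) s c')) (th i)) =
  @epair _ (carrier U) s s u c' by apply: env_eq => -[[[]|]|].
by rewrite !E !ipred_dsym mdistxx => /esym/mdist_positivity.
Qed.

Definition swap (t : sorts L) (b : U t) : U t :=
  if pselect (existT (fun t => U t : Type) t b = existT _ s c') is left e
  then eq_rect s (fun t => U t : Type) c t (esym (projT1_eq e)) else b.

Lemma swapE : swap c' = c.
Proof.
rewrite /swap; case: pselect => // e.
by rewrite (Prop_irrelevance (esym _) erefl).
Qed.

Lemma swap_id (t : sorts L) (b : U t) :
  existT (fun t => U t : Type) t b <> existT _ s c' -> swap b = b.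
Proof. by rewrite /swap; case: pselect. Qed.

(** Types over [A] speak of one variable and of parameters in [A], elementarity of
    arbitrary tuples in which [c'] may occur several times, at positions for which
    [A] may have no element at all: the context has to be shortened. *)
Lemma swap_substitution (Gamma : ctx L) (e : tup U Gamma) : ~ @A s c' ->
  inp (padd A c') e -> exists (Delta : ctx L) (d : tup U Delta)
    (th : substitution Gamma (s :: Delta)), inp A d /\
  forall i, teval (mcons c' d) (th i) = e i /\ teval (mcons c d) (th i) = swap (e i).
Proof.
move=> nAc'; elim: Gamma e => [|t Gamma IH] e inpe.
  by exists [::], (@enil _ (carrier U)), (fun i : pos [::] => match i with end); split=> -[].
have [Delta [d [th [Ad thP]]]] := IH (fun i => e (Some i)) (fun i => inpe (Some i)).
have [At|eq] := inpe None.
  exists (t :: Delta), (mcons (e None : U t) d).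
  pose wk : substitution (s :: Delta) (s :: t :: Delta) :=
    @slift R L s _ _ (@shift R L t Delta).
  exists (fun i => match i return term (s :: t :: Delta) (@sortat _ (t :: Gamma) i) with
    | None => @tvar R L (s :: t :: Delta) (Some None)
    | Some k => tsubst wk (th k) end).
  have wkE (u : U s) : (fun i => teval (mcons u (mcons (e None : U t) d)) (wk i)) = mcons u d.
    by apply: env_eq => -[i|].
  split=> [[i|]|[i|]] //=; first by rewrite !teval_subst !wkE.
  by split=> //; rewrite swap_id// => E; apply: nAc'; exact: pset_existT E At.
have ts : s = t := esym (projT1_eq eq).
subst t; have eN := existT_inj eq.
exists Delta, d.
exists (fun i => match i return term (s :: Delta) (@sortat _ (s :: Gamma) i) with
    | None => @tvar R L (s :: Delta) None
    | Some k => th k end).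
by split=> // -[i|] //=; rewrite eN swapE.
Qed.

Lemma swap_elementary : ~ @A s c' -> elementary_on (padd A c') swap.
Proof.
move=> nAc' Gamma psi e /(swap_substitution nAc')[Delta [d [th [Ad thP]]]].
rewrite (_ : mmap swap e = fun i => teval (mcons c d) (th i)); last first.
  by apply: env_eq => i; have [_ ->] := thP i.
rewrite (_ : feval psi e = feval psi (fun i => teval (mcons c' d) (th i))); last first.
  by congr feval; apply: env_eq => i; have [->] := thP i.
by rewrite -!feval_subst tp_feval.
Qed.

Lemma conjugate (K : Type) : infinite_set [set: K] -> strongly_homogeneous K U ->
  small K A -> exists sigma : automorphism U, fixes A sigma /\ sigma s c' = c.
Proof.
move=> Kinf homU smA; have [Ac'|nAc'] := pselect (@A s c').
  by exists (identity_automorphism U); split=> //; rewrite (tp_eq_in Ac').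
have [sigma sP] := homU _ (small_padd c' Kinf smA) _ (swap_elementary nAc').
exists sigma; split=> [t b Ab|]; last by rewrite sP ?swapE//; right.
rewrite sP ?swap_id//; last by left.
by move=> E; apply: nAc'; exact: pset_existT E Ab.
Qed.

End Conjugation.

End Monster.

(** * Minimal flows *)

Section Flow.
Variables (R : realType) (Y : Type) (G : set (Y -> Y)).
Hypotheses (G1 : G id) (GM : forall g h, G g -> G h -> G (g \o h))
  (Gsurj : forall g, G g -> forall b, exists b', g b' = b).
Implicit Types (X Z : set (Y -> R)) (f q : Y -> R).

(** For functions with values in [0, 1], this is compactness for pointwise
    convergence. *)
Definition limit_closed X : Prop :=
  forall D : set_system (Y -> R), UltraFilter D -> D X ->
  X (fun b => ulim D (fun f => f b)).

Definition subflow X : Prop :=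
  [/\ X !=set0, limit_closed X & forall g f, G g -> X f -> X (f \o g)].

(** Along a chain of subflows, limit points with respect to an ultrafilter containing
    the chain are in its intersection. *)
Lemma minimal_subflow X : subflow X -> exists Z, [/\ subflow Z, Z `<=` X &
  forall Z', subflow Z' -> Z' `<=` Z -> Z' = Z].
Proof.
move=> flX; pose S := {Z | subflow Z /\ Z `<=` X}.
pose Rel (s t : S) := `[< sval t `<=` sval s >].
have [||| |[Z [flZ ZX]] Zmin] := @Zorn S Rel.
- by move=> s; apply/asboolP.
- by move=> r s t /asboolP rs /asboolP st; apply/asboolP => f /st/rs.
- move=> [s sP] [t tP] /asboolP st /asboolP ts; apply: eq_exist => /=.
  exact/seteqP.
- move=> C Ctot; have [[s0 Cs0]|C0] := pselect (exists s, C s); last first.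
    by exists (exist _ X (conj flX (@subset_refl _ X))) => s Cs; case: C0; exists s.
  pose I := \bigcap_(s in C) sval s.
  have IX : I `<=` X by move=> f /(_ _ Cs0); case: (svalP s0) => _; apply.
  suff flI : subflow I.
    by exists (exist _ I (conj flI IX)) => s Cs; apply/asboolP => f /(_ _ Cs).
  split.
  + have FF : ProperFilter (filter_from C sval).
      apply: filter_from_proper; last by move=> s Cs; case: (svalP s) => -[].
      apply: filter_from_filter; first by exists s0.
      move=> s t Cs Ct; have [/asboolP st|/asboolP ts] := Ctot _ _ Cs Ct.
        by exists t => // f tf; split=> //; exact: st.
      by exists s => // f sf; split=> //; exact: ts.
    have [D [UD FD]] := ultraFilterLemma FF.
    exists (fun b => ulim D (fun f => f b)) => s Cs.
    case: (svalP s) => -[_ + _] _; apply=> //.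
    by apply: FD; exists s.
  + move=> D UD DI s Cs; case: (svalP s) => -[_ + _] _; apply=> //.
    by apply: filterS DI => f /(_ _ Cs).
  + by move=> g f Gg If s Cs; case: (svalP s) => -[_ _ +] _; apply=> //; exact: If.
- exists Z; split=> // Z' flZ' Z'Z.
  have Z'X : Z' `<=` X by move=> f /Z'Z/ZX.
  have := Zmin (exist _ Z' (conj flZ' Z'X)) _.
  by move=> H; have [] := H (asboolT Z'Z).
Qed.

(** In a minimal flow the translates of a nonempty open set cover everything,
    hence finitely many of them do; the elements of [G] being surjective, all
    translates of a set of small diameter have small diameter. *)
Lemma minimal_subflow_totally_bounded Z (eps : R) N : 0 < eps -> (0 < N)%N ->
  subflow Z -> (forall Z', subflow Z' -> Z' `<=` Z -> Z' = Z) ->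
  (forall f b, Z f -> 0 <= f b <= 1) -> ~ alternating Z (eps / 8) N ->
  exists n (colour : (Y -> R) -> nat), (forall f, Z f -> (colour f < n)%N) /\
    forall f f', Z f -> Z f' -> colour f = colour f' -> forall b, `|f b - f' b| <= eps.
Proof.
move=> eps0 N0 [Z0 Zlim Zinv] Zmin Z01 nalt.
have [z [l [d [Zz d0 diam]]]] := fragmentation eps0 Z0 N0 Z01 nalt.
pose O f := all (fun b => `|f b - z b| < d) l.
have O_limit (D : set_system (Y -> R)) g : UltraFilter D -> D Z -> G g ->
    O ((fun b => ulim D (fun f => f b)) \o g) -> D [set f : Y -> R | O (f \o g)].
  move=> UD DZ Gg; rewrite /O; elim: (l) => [_|b l' IH /= /andP[bd /IH Dl']].
    exact: filterE.
  have [f0 Zf0] := Z0.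
  have uc : (fun f => f (g b)) @ D --> ulim D (fun f : Y -> R => f (g b)).
    pose v f := if pselect (Z f) then f (g b) else 0 : R.
    have v01 f : 0 <= v f <= 1.
      rewrite /v; case: pselect => [Zf|?]; first exact: Z01.
      by rewrite lexx ler01.
    have uv : \forall f \near D, v f = f (g b).
      by apply: filterS DZ => f Zf; rewrite /v; case: pselect.
    have vc := ulim_cvg UD v01.
    have fc : (fun f : Y -> R => f (g b)) @ D --> ulim D v.
      by apply/cvgrPdist_lt => e e0; apply: filterS (ultraI UD uv (cvgD_dist UD vc e0)) => f [<-].
    by rewrite (ulim_eq UD fc).
  have e0 : 0 < d - `|ulim D (fun f => f (g b)) - z b| by rewrite subr_gt0.
  apply: filterS (ultraI UD Dl' (cvgD_dist UD uc e0)) => f [/= -> /=]; rewrite andbT.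
  by rewrite distrC => h; rewrite -[X in `|X|](subrKA (ulim D (fun f => f (g b))));
    apply: le_lt_trans (ler_normD _ _) _; move: h; lra.
have cover f : Z f -> exists2 g, G g & O (f \o g).
  move=> Zf; apply: contrapT => nof.
  pose Z' := [set f | Z f /\ forall g, G g -> ~ O (f \o g)].
  have : Z' = Z.
    apply: Zmin; last by move=> ? [].
    split.
    - by exists f; split=> // g Gg Og; apply: nof; exists g.
    - move=> D UD DZ'; have DZ : D Z by apply: filterS DZ' => ? [].
      split=> [|g Gg Og]; first exact: Zlim.
      have [f' [[_ Hf'] Of']] := filter_ex (ultraI UD DZ' (O_limit D g UD DZ Gg Og)).
      exact: Hf' Gg Of'.
    - move=> g f' Gg [Zf' nof']; split=> [|h Gh]; first exact: Zinv.
      exact: (nof' _ (GM Gg Gh)).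
  move=> E; have [_ /(_ id G1)] : Z' z by rewrite E.
  apply; rewrite /O (@eq_all _ _ predT) ?all_predT// => b /=.
  by rewrite subrr normr0 d0.
(* Otherwise some ultrafilter avoids all the translates of [O], and so does its
   limit. *)
have [s sP] : exists s : seq (Y -> Y), forall f, Z f -> exists i,
    [/\ (i < size s)%N, G (nth id s i) & O (f \o nth id s i)].
  apply: contrapT => nos.
  pose C (s : seq (Y -> Y)) := [set f | Z f /\
    forall i, (i < size s)%N -> G (nth id s i) -> ~ O (f \o nth id s i)].
  have FF : ProperFilter (filter_from [set: seq (Y -> Y)] C).
    apply: filter_from_proper; last first.
      move=> s _; apply: contrapT => Cs; apply: nos; exists s => f Zf.
      apply: contrapT => no; apply: Cs; exists f; split=> // i i_s Gi Oi.
      by apply: no; exists i.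
    apply: filter_from_filter; first by exists [::].
    move=> s t _ _; exists (s ++ t) => // f [Zf Hf]; split; split=> // i i_s Gi.
      by have := Hf i; rewrite nth_cat i_s size_cat; apply=> //; rewrite ltn_addr.
    have := Hf (size s + i)%N; rewrite nth_cat (ltnNge _ (size s)) leq_addr /= addKn.
    by rewrite size_cat ltn_add2l; apply.
  have [D [UD FD]] := ultraFilterLemma FF.
  have DC s : D (C s) by apply: FD; exists s.
  have DZ : D Z by apply: filterS (DC [::]) => f [].
  have [g Gg Og] := cover _ (Zlim D UD DZ).
  have [f [[_ Hf] Of]] := filter_ex (ultraI UD (DC [:: g]) (O_limit D g UD DZ Gg Og)).
  exact: (Hf 0%N isT Gg).
have /choice[colour cP] f : exists i, Z f ->
    [/\ (i < size s)%N, G (nth id s i) & O (f \o nth id s i)].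
  by have [/sP[i iP]|nZ] := pselect (Z f); [exists i|exists 0%N].
exists (size s), colour; split=> [f /cP[]//|f f' Zf Zf' ff' b].
have [_ Gg Of] := cP f Zf; have [_ _ Of'] := cP f' Zf'; rewrite -ff' in Of'.
have [b' <-] := Gsurj Gg b.
exact: (diam _ _ (Zinv _ _ Gg Zf) (Zinv _ _ Gg Zf') Of Of').
Qed.

End Flow.

(** * Spaces of types *)

Section Automorphisms.
Variables (R : realType) (L : signature R) (U : structure L).
Implicit Types (sigma tau : automorphism U).

Lemma autm_teval sigma Gamma (e : tup U Gamma) s (t : term Gamma s) :
  teval (mmap sigma e) t = sigma s (teval e t).
Proof.
elim: t => {s} [//|Delta s f t IH] /=; rewrite autm_fun; congr ifun.
by apply: env_eq => i; rewrite IH.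
Qed.

Lemma autm_feval sigma Gamma (f : formula Gamma) (e : tup U Gamma) :
  feval f (mmap sigma e) = feval f e.
Proof.
have range_eq s D (g : formula (s :: D)) (d : tup U D) :
    (forall d' : tup U (s :: D), feval g (mmap sigma d') = feval g d') ->
    [set feval g (mcons a (mmap sigma d)) | a in [set: U s]] =
    [set feval g (mcons a d) | a in [set: U s]].
  move=> H; have E (a : U s) : mcons (sigma s a) (mmap sigma d) = mmap sigma (mcons a d).
    by apply: env_eq => -[].
  apply/seteqP; split=> _ [a _ <-].
    have [h hK Kh] := autm_bij sigma s; exists (h a) => //.
    by rewrite -H -E Kh.
  by exists (sigma s a) => //; rewrite E H.
elim: f e => {Gamma} [Gamma D P t|Gamma f IH|Gamma f IH|Gamma f IHf g IHg
  |Gamma s f IH|Gamma s f IH] e /=.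
- by rewrite -[RHS](autm_pred sigma); congr ipred; apply: env_eq => i; rewrite autm_teval.
- by rewrite IH.
- by rewrite IH.
- by rewrite IHf IHg.
- by rewrite range_eq.
- by rewrite range_eq.
Qed.

Definition autm_comp sigma tau : automorphism U.
Proof.
exists (fun s => sigma s \o tau s).
- by move=> s; apply: bij_comp; exact: autm_bij.
- by move=> Gamma s f e /=; rewrite !autm_fun.
- by move=> Gamma P e; rewrite -[RHS](autm_pred tau) -[RHS](autm_pred sigma).
Defined.

Lemma mmap_surjective sigma Gamma (b : tup U Gamma) : exists b', mmap sigma b' = b.
Proof.
have /dependent_choice_fun[b' b'P] : forall i : pos Gamma, exists c, sigma _ c = b i.
  by move=> i; have [h hK Kh] := autm_bij sigma (sortat i); exists (h (b i)).
by exists b'; apply: env_eq.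
Qed.

End Automorphisms.

Lemma ptws_cvg (R : realType) (T : Type) (F : set_system (T -> R)) (f : T -> R) : Filter F ->
  (forall t, (fun g => g t) @ F --> f t) -> F --> (f : {ptws T -> R}).
Proof.
move=> FF H; apply/cvg_sup => t A.
rewrite nbhsE => -[O [[V Vo VO] Of] OA].
have : F ((fun g => g t) @^-1` V).
  by apply: H; apply: open_nbhs_nbhs; split=> //; move: Of; rewrite -VO.
by apply: filterS => g Vg; apply: OA; rewrite -VO.
Qed.

Lemma eval_continuous (R : realType) (T : Type) (t : T) :
  continuous (fun g : {ptws T -> R} => g t).
Proof.
move=> g; have /cvg_sup/(_ t) H : g --> g by exact: cvg_id.
apply: cvg_trans (cvg_app _ H) _.
exact: initial_continuous.
Qed.

Section TypeSpaces.
Variables (R : realType) (L : signature R).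

Lemma tvalue01 (M : structure L) (B : pset M) (x : ctx L) (p : ctype B x) psi :
  0 <= tvalue p psi <= 1.
Proof.
case: (svalP (p : ctype_ B x)) => N [h [a pE]].
by rewrite /tvalue pE; exact: feval01.
Qed.

Lemma tvalue_continuous (M : structure L) (B : pset M) (x : ctx L) (psi : pformula B x) :
  continuous (fun t : ctype B x => tvalue t psi).
Proof.
move=> t.
have H1 := @initial_continuous (ctype_ B x) {ptws pformula B x -> R}
  (fun p : ctype_ B x => sval p : {ptws pformula B x -> R}) t.
have H2 : (fun g : pformula B x -> R => g psi)
    @ nbhs (sval t : {ptws pformula B x -> R}) --> (sval t : pformula B x -> R) psi.
  exact: eval_continuous.
exact: cvg_comp H1 H2.
Qed.

Lemma tvalue_is_predicate (M : structure L) (B : pset M) (x : ctx L)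
    (psi : pformula B x) : is_predicate (fun t : ctype B x => tvalue t psi).
Proof. by split; [exact: tvalue_continuous|move=> t; exact: tvalue01]. Qed.

Lemma ctype_cvg (I : Type) (D : set_system I) (UD : UltraFilter D)
    (M : structure L) (B : pset M) (x : ctx L) (r : I -> ctype B x) (r' : ctype B x) :
  (forall psi, tvalue r' psi = ulim D (fun i => tvalue (r i) psi)) -> r @ D --> r'.
Proof.
move=> rr'; have FF : Filter ((fun i => tvalue (r i)) @ D) by exact: fmap_filter.
have : {ptws, (fun i => tvalue (r i)) @ D --> tvalue r'}.
  apply: ptws_cvg => psi; rewrite rr'.
  by apply: (ulim_cvg UD (u := fun i => tvalue (r i) psi)) => i; exact: tvalue01.
move=> H A; rewrite nbhsE => -[O [[V Vo VO] Or'] OA].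
have DV : D ((fun i => tvalue (r i)) @^-1` V).
  by apply: H; apply: open_nbhs_nbhs; split=> //; move: Or'; rewrite -VO.
apply: filterS DV => i iV; apply: OA; rewrite -VO.
exact: iV.
Qed.

Lemma tp_eqP (M : structure L) (B : pset M) (x : ctx L) (a b : tup M x) :
  tp B a = tp B b <->
  forall psi : pformula B x, pvalue (eemb_id M) a psi = pvalue (eemb_id M) b psi.
Proof.
split=> [ab psi|ab]; first by have := congr1 (fun t => tvalue t psi) ab.
by apply: eq_exist; apply: funext.
Qed.

Lemma phi_rel_phicl (M : structure L) (B : pset M) (x y : ctx L) (phi : formula (x ++ y))
    (p : ctype B x) (b : tup M y) (Bb : inp B b) :
  phivalue (phicl phi p) Bb = tvalue p (inst phi Bb).
Proof.
have /eqmodP/asboolP := reprK (phicl phi p : {eq_quot (phi_equiv phi B)}%qT).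
exact.
Qed.

Lemma phicl_continuous (M : structure L) (B : pset M) (x y : ctx L)
    (phi : formula (x ++ y)) : continuous (@phicl R L x y phi M B).
Proof. exact: pi_continuous. Qed.

End TypeSpaces.

(** * Global types and canonical parameters *)

Section GlobalTypes.
Variables (R : realType) (L : signature R) (T : theory L) (x y : ctx L).
Variables (phi : formula (x ++ y)) (U : structure L).
Hypotheses (phi_stable : stable T phi) (UT : models U T).
Local Notation full := (@pfull R L U).

Definition full_inp (b : tup U y) : inp full b := fun _ => I.

(** A [phi]-type is determined by this function, and the action of an automorphism
    on it is precomposition. *)
Definition instances (r : ctype full x) : tup U y -> R :=
  fun b => tvalue r (inst phi (full_inp b)).

Definition realised : set (tup U y -> R) :=
  [set f | exists a : tup U x, f = fun b => feval phi (ecat a b)].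

Lemma instances_adherent r : adherent realised (instances r).
Proof.
case: (svalP (r : ctype_ full x)) => N [h [a rE]].
have [b0] := tup_inh U y.
have [D [UD HD]] := type_ultrafilter h a (inst phi (full_inp b0)).
exists ((fun m b => feval phi (ecat m b)) @ D); split; first exact: ultrafilter_map.
  by apply: (@filterE _ D) => m; exists m.
move=> b e e0; apply: filterS (HD (inst phi (full_inp b)) e e0) => m /=.
by rewrite /instances /tvalue rE; exact: id.
Qed.

(** An alternation uses finitely many values, so that types can be replaced by
    tuples of [U] up to a small error. *)
Lemma instances_not_alternating (eps : R) : 0 < eps ->
  exists N, (0 < N)%N /\ ~ alternating (range instances) eps N.
Proof.
move=> eps0; have e0 : 0 < eps / 2 by rewrite divr_gt0.
exists (Nalt T phi (eps / 2)); split; first exact: Nalt_gt0 UT e0 phi_stable.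
set N := Nalt _ _ _; move=> [f [b [fr fb]]].
have /no_alternationP HN := no_alternation_Nalt e0 phi_stable.
have e40 : 0 < eps / 4 by rewrite divr_gt0.
have /choice[a aP] j : exists a : tup U x, forall i : 'I_N.+1,
    `|feval phi (ecat a (b i)) - f j (b i)| < eps / 4.
  have [r _ <-] := fr j; have [D [UD DE Dr]] := instances_adherent r.
  have DI : D [set g | forall i : 'I_N.+1, `|g (b i) - instances r (b i)| < eps / 4].
    by apply: filter_forall => i; exact: Dr.
  by have [_ [[a ->] H]] := filter_ex (ultraI UD DE DI); exists a.
apply: (HN U a b UT) => i j k ijk kN.
have iN : (i < N.+1)%N by case/andP: ijk => *; lia.
have := fb i j k ijk kN; have := aP j (Ordinal iN).
have := aP j (Ordinal (kN : (k < N.+1)%N)).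
rewrite /= !ltr_distlC !ler_normr => h1 h2 /orP[] h; apply/orP; [left|right]; lra.
Qed.

Variables (A : pset U) (p : phitype_set phi A).

Definition extensions : set (tup U y -> R) :=
  [set f | exists r : ctype full x, f = instances r /\ phiset_cl A (phicl phi r) = p].

Definition fixing : set (tup U y -> tup U y) :=
  [set g | exists sigma : automorphism U, fixes A sigma /\ g = fun b => mmap sigma b].

Lemma phiset_clP (r r' : phitype phi full) : phiset_cl A r = phiset_cl A r' <->
  forall f, phi_predicate_over A f -> f r = f r'.
Proof.
split=> [/eqmodP/asboolP //|H].
by apply/eqmodP/asboolP.
Qed.

(** Predicates over [A] are continuous, hence their values pass to limits of types,
    and they are invariant under automorphisms fixing [A] by definition. *)
Lemma extensions_subflow : subflow fixing extensions.
Proof.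
split.
- pose r0 : phitype phi full := repr (p : {eq_quot (phiset_equiv phi A)}%qT).
  pose r : ctype full x := repr (r0 : {eq_quot (phi_equiv phi full)}%qT).
  exists (instances r), r; split=> //.
  by rewrite /phicl reprK /phiset_cl reprK.
- move=> D UD DX.
  have [_ [r0 [_ r0p]]] := filter_ex DX.
  have /choice[r rP] f : exists r : ctype full x,
      (extensions f -> f = instances r) /\ phiset_cl A (phicl phi r) = p.
    have [[r [fr rp]]|nf] := pselect (extensions f); first by exists r.
    by exists r0.
  have [r' r'P] := type_limit UD r; exists r'; split.
    apply: funext => b; rewrite /instances r'P; apply: (ulim_congr UD).
    by apply: filterS DX => f /((rP f).1) {1}->.
  rewrite -r0p; apply/phiset_clP => f fA; have [[fc _] _] := fA.
  have rc : (fun g => f (phicl phi (r g))) @ D --> f (phicl phi r').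
    apply: (@cvg_comp _ _ _ r (fun t => f (phicl phi t))); first exact: ctype_cvg r'P.
    exact: cvg_comp (@phicl_continuous R L U full x y phi r') (fc _).
  rewrite -(ulim_eq UD rc); apply: ulim_near_eq; apply: filterE => g.
  by have := (rP g).2; rewrite -r0p => /phiset_clP; apply.
- move=> _ _ [sigma [sA ->]] [r [-> rp]].
  case: (svalP (r : ctype_ full x)) => N [h [a rE]].
  have elem Gamma (f : formula Gamma) (e : tup U Gamma) :
      feval f (mmap (fun s (c : U s) => h s (sigma s c)) e) = feval f e.
    by rewrite -[RHS](autm_feval sigma) -[RHS](eembP h).
  have isr : is_type (fun psi : pformula full x => tvalue r (paut sigma psi)).
    by exists N, (ElementaryEmbedding elem), a; apply: funext => psi; rewrite /tvalue rE.
  exists (exist _ _ isr : ctype_ full x); split=> //.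
  rewrite -rp; apply/phiset_clP => f [_ finv]; apply/esym; exact: (finv sigma).
Qed.

Lemma fixing_id : fixing id.
Proof. by exists (identity_automorphism U). Qed.

Lemma fixing_comp g h : fixing g -> fixing h -> fixing (g \o h).
Proof.
move=> [sigma [sA ->]] [tau [tA ->]]; exists (autm_comp sigma tau); split=> //.
by move=> s a Aa; rewrite /= tA// sA.
Qed.

Lemma fixing_surjective g : fixing g -> forall b, exists b', g b' = b.
Proof. by move=> [sigma [_ ->]] b; exact: mmap_surjective. Qed.

Lemma totally_bounded_extensions : exists Z : set (tup U y -> R),
  [/\ Z !=set0, Z `<=` extensions, forall g f, fixing g -> Z f -> Z (f \o g) &
  forall eps, 0 < eps -> exists n (colour : (tup U y -> R) -> nat),
    (forall f, Z f -> (colour f < n)%N) /\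
    forall f f', Z f -> Z f' -> colour f = colour f' -> forall b, `|f b - f' b| <= eps].
Proof.
have [Z [flZ ZX Zmin]] := minimal_subflow extensions_subflow.
have [Z0 _ Zinv] := flZ; exists Z; split=> // eps eps0.
have e80 : 0 < eps / 8 by rewrite divr_gt0.
have [N [N0 nalt]] := instances_not_alternating e80.
apply: (minimal_subflow_totally_bounded fixing_id fixing_comp fixing_surjective
  eps0 N0 flZ Zmin).
  by move=> f b /ZX[r [-> _]]; exact: tvalue01.
move=> [f [b [fZ fb]]]; apply: nalt; exists f, b; split=> // n.
by have [r [-> _]] := ZX _ (fZ n); exists r.
Qed.

End GlobalTypes.

Lemma ecat_single_dist (R : realType) (L : signature R) (U : structure L) (y : ctx L)
    (S : sorts L) (b : tup U y) (c c' : U S) (d : R) : 0 < d -> mdist c c' < d ->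
  forall i, mdist (mcat b (@esingle _ (carrier U) S c) i)
    (mcat b (@esingle _ (carrier U) S c') i) < d.
Proof.
move=> d0 cd; elim: y b => [|s G IH] b.
  by case=> [[]|].
by case=> [i|] /=; [exact: (IH (fun k => b (Some k)) i)|rewrite mdistxx].
Qed.

Section CanonicalParameters.
Variables (R : realType) (L : signature R) (T : theory L) (x y : ctx L).
Variables (phi : formula (x ++ y)) (U : structure L) (S : sorts L) (P : psym (y ++ [:: S])).
Hypotheses (UT : models U T) (canP : canonical_parameter_sort T phi P).

Definition pval (c : U S) (b : tup U y) : R :=
  ipred P (mcat b (@esingle _ (carrier U) S c)).

(** For classes of families this is the definition of the distance; such classes
    are dense, and [P] is uniformly continuous. *)
Lemma canonical_mdist_le (c c' : U S) (eps : R) :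
  (forall b, `|pval c b - pval c' b| <= eps) -> mdist c c' <= eps.
Proof.
move=> cc'; have [cl [cl_dist cl_dense clP]] := canP UT.
apply/ler_addgt0Pr => e e0; have e40 : 0 < e / 4 by rewrite divr_gt0.
have [d d0 Hd] := ipred_joint_modulus P e40.
have d'0 : 0 < Num.min d (e / 4) by rewrite lt_min d0.
have near_cl (c0 : U S) : exists C : dfamily T phi U, mdist (cl C) c0 < e / 4 /\
    forall b, `|dphi C b - pval c0 b| <= e / 4.
  have : closure (range cl) c0 by rewrite cl_dense.
  move=> /(_ (ball c0 (Num.min d (e / 4)))) []; first exact: nbhsx_ballx.
  move=> _ [[C _ <-]]; rewrite ballEmdist /= lt_min => /andP[Cd Ce].
  exists C; split; first by rewrite metric_sym.
  move=> b; rewrite -clP; apply: Hd; apply: ecat_single_dist => //.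
  by rewrite metric_sym.
have [C [Cc CP]] := near_cl c; have [C' [C'c C'P]] := near_cl c'.
have : mdist (cl C) (cl C') <= eps + e / 4 + e / 4.
  rewrite cl_dist; apply: ge_sup.
    by have [b] := tup_inh U y; exists `|dphi C b - dphi C' b|, b.
  move=> _ [b _ <-]; have := cc' b; have := CP b; have := C'P b.
  by rewrite !ler_distlC; lra.
have := metric_triangle c (cl C) c'; have := metric_triangle (cl C) (cl C') c'.
by move: Cc; rewrite (metric_sym _ c); lra.
Qed.

Lemma canonical_parameter (q : tup U y -> R) : stable T phi ->
  (forall b, 0 <= q b <= 1) -> adherent (@realised R L x y phi U) q ->
  exists c : U S, pval c = q.
Proof.
move=> st q01 qa; have [C CP] := dphi_adherent st UT q01 qa.
have [cl [_ _ clP]] := canP UT; exists (cl C); apply: funext => b.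
by rewrite -CP -clP.
Qed.

Lemma pval_aut (sigma : automorphism U) (c : U S) b :
  pval (sigma S c) (mmap sigma b) = pval c b.
Proof.
rewrite /pval -[RHS](autm_pred sigma) emap_cat; congr ipred; congr ecat.
by apply: env_eq => -[[]|].
Qed.

End CanonicalParameters.

(** * Algebraicity *)

Section AlgebraicParameters.
Variables (R : realType) (L : signature R) (U : structure L).
Variables (A : pset U) (S : sorts L) (c : U S).
Local Notation single a := (@esingle _ (carrier U) S a).

Definition same_type (B : pset U) : set (U S) :=
  [set c' | tp B (single c') = tp B (single c)].

Lemma same_type_sub (B B' : pset U) : psub B B' -> same_type B' `<=` same_type B.
Proof.
move=> BB' c' /tp_eqP H; apply/tp_eqP => psi.
exact: (H (pwiden BB' psi)).
Qed.

Lemma pigeonhole_colour (colour : nat -> nat) n : (forall i, (colour i < n)%N) ->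
  exists i k, (i < k)%N /\ colour i = colour k.
Proof.
move=> cn; pose f (i : 'I_n.+1) : 'I_n := Ordinal (cn i).
have [i [k [ik fik]]] : exists i k, i <> k /\ f i = f k.
  apply: contrapT => H; have /leq_card : injective f.
    by move=> i k fik; apply: contrapT => ik; apply: H; exists i, k.
  by rewrite !card_ord ltnn.
have /(congr1 val) /= E := fik.
by have [lt|lt|/val_inj//] := ltngtP (i : nat) k; [exists i, k|exists k, i].
Qed.

Lemma ultra_colour (I : Type) (D : set_system I) (X : set I) (colour : I -> nat) n :
  UltraFilter D -> D X -> (forall i, X i -> (colour i < n)%N) ->
  exists k, D (X `&` [set i | colour i = k]).
Proof.
move=> UD; elim: n X => [|n IH] X DX Xn.
  by have [i /Xn] := filter_ex DX.
have [DE|DE] := in_ultra_setVsetC [set i | colour i = n] UD.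
  by exists n; exact: ultraI.
have [|i [Xi /= ine]|k Dk] := IH (X `&` ~` [set i | colour i = n]).
- exact: ultraI.
- by have := Xn i Xi; rewrite ltnS leq_eqVlt => /orP[/eqP|].
- by exists k; apply: filterS Dk => i [[]].
Qed.

Hypothesis bounded : forall eps : R, 0 < eps -> exists n (colour : U S -> nat),
  (forall a, same_type A a -> (colour a < n)%N) /\
  forall a b, same_type A a -> same_type A b -> colour a = colour b -> mdist a b <= eps.

(** Realisations of a type form a closed set, and an ultrafilter on a totally
    bounded set is Cauchy. *)
Lemma totally_bounded_acl : @acl R L U A S c.
Proof.
rewrite /acl /= -/(same_type A) compact_ultra => D UD DX.
have Dball e : 0 < e -> exists2 a : U S, same_type A a & D [set b | mdist a b < e].
  move=> e0; have e20 : 0 < e / 2 by rewrite divr_gt0.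
  have [n [colour [cn cdist]]] := bounded e20.
  have [k Dk] := ultra_colour UD DX cn.
  have [a [Xa ak]] := filter_ex Dk; exists a => //.
  apply: filterS Dk => b [Xb bk] /=.
  by apply: le_lt_trans (cdist _ _ Xa Xb _) _; [rewrite ak bk|lra].
have [|a Da] := carrier_complete (F := D) _.
  by apply/metric_cauchyP => e /Dball[a _ Da]; exists a.
exists a; split=> //=; apply/tp_eqP => -[Delta f d dP].
apply/eqP; rewrite -subr_eq0 -normr_le0; apply/ler_addgt0Pl => e e0; rewrite addr0.
have [del del0 Hdel] := feval_modulus f e0.
move: Da => /metric_cvgP/(_ del del0) Da.
have [b [Xb ab]] := filter_ex (ultraI UD DX Da).
move: Xb => /tp_eqP/(_ (PFormula f dP)) <-.
by apply: Hdel => -[i|] /=; [rewrite mdistxx|exact: ab].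
Qed.

Lemma feval_dsym (a b : U S) :
  feval (@fatom R L [:: S; S] _ (dsym S) (fun i => tvar i)) (mcat (single a) (single b)) =
  mdist a b.
Proof. by rewrite /= -ipred_dsym; congr ipred; apply: env_eq => -[[[]|]|]. Qed.

Lemma inp_single (B : pset U) (a : U S) : B S a -> inp B (single a).
Proof. by move=> Ba [[]|]. Qed.

Definition distance_to (B : pset U) (a : U S) (Ba : B S a) : pformula B [:: S] :=
  @PFormula R L U B [:: S] [:: S]
    (@fatom R L [:: S; S] _ (dsym S) (fun i => tvar i)) (single a) (inp_single Ba).

Lemma pvalue_distance_to (B : pset U) (a b : U S) (Ba : B S a) :
  pvalue (eemb_id U) (single b) (distance_to Ba) = mdist b a.
Proof.
by rewrite -feval_dsym; congr feval; congr ecat.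
Qed.

Variables (K : Type) (M : structure L) (j : elementary_embedding M U).
Hypotheses (Kinf : infinite_set [set: K]) (satU : saturated K U).
Hypotheses (smM : small K (prange j)) (AM : psub A (prange j)).

Lemma eemb_mdist s (a b : M s) : mdist (j s a) (j s b) = mdist a b.
Proof.
pose f := @fatom R L [:: s; s] _ (dsym s) (fun i => tvar i).
have E (V : structure L) (a' b' : V s) : feval f (@epair _ (carrier V) s s a' b') = mdist a' b'.
  by rewrite -ipred_dsym.
rewrite -!E -(eembP j f); congr feval.
by apply: env_eq => -[[[]|]|].
Qed.

(** The image of the complete structure [M] under the isometry [j] is closed. *)
Lemma closed_prange : (forall eps, 0 < eps -> exists m : M S, mdist (j S m) c < eps) ->
  prange j S c.
Proof.
move=> H; have /choice[m mP] n : exists m : M S, mdist (j S m) c < 2 ^- n.+1.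
  exact/H/expr_half_gt0.
have [n||a aP] := @geometric_limit R (M S) m.
- rewrite -eemb_mdist; apply: le_trans (metric_triangle _ c _) _.
  have := mP n; have := mP n.+1; rewrite (metric_sym c) (expr_halfS _ n.+1) (expr_halfS _ n).
  by have := expr_half_gt0 R n; lra.
- exact: carrier_complete.
exists a => //; apply: mdist_positivity; apply/eqP; rewrite eq_le mdist_ge0 andbT.
apply/ler_addgt0Pl => e e0; rewrite addr0; have e40 : 0 < e / 4 by rewrite divr_gt0.
have [n ne] := expr_half_small e40.
apply: le_trans (metric_triangle _ (j S (m n)) _) _.
have := aP n; have := mP n; rewrite -eemb_mdist (metric_sym (j S a)) expr_halfS.
by have := expr_half_gt0 R n; lra.
Qed.

(** If [c] is not in [M], it has positive distance from [M]; then so has every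
    realisation of a coheir of its type, and taking successive coheirs gives an
    infinite separated set of realisations of the type of [c] over [M]. *)
Lemma acl_in_model : prange j S c.
Proof.
apply: closed_prange => eps eps0; apply: contrapT => far.
have {}far (m : M S) : eps <= mdist (j S m) c.
  by rewrite leNgt; apply/negP => mc; apply: far; exists m.
have [m0] := carrier_inh M S.
pose f0 : pformula (@pfull R L M) [:: S] := @PFormula R L M (@pfull R L M) [:: S] [:: S]
  (@fatom R L [:: S; S] _ (dsym S) (fun i => tvar i))
  (@esingle _ (carrier M) S m0) (fun _ => I).
have [D [UD HD]] := type_ultrafilter j (single c) f0.
have limD (Delta : ctx L) (f : formula ([:: S] ++ Delta)) (d : tup U Delta) :
    inp (prange j) d ->
    ulim D (fun m => feval f (mcat (mmap j m) d)) = feval f (mcat (single c) d).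
  move=> dj; have /dependent_choice_fun[d' d'P] : forall i : pos Delta, exists m, j _ m = d i.
    by move=> i; have [m _ <-] := dj i; exists m.
  have dE : d = mmap j d' by apply: env_eq => i; rewrite -d'P.
  apply: (ulim_eq UD); apply/cvgrPdist_lt => e e0.
  have := HD (@PFormula R L M (@pfull R L M) [:: S] Delta f d' (fun _ => I)) e e0.
  have E (m : tup M [:: S]) : feval f (mcat (mmap j m) d) = feval f (mcat m d').
    by rewrite dE -[RHS](eembP j) emap_cat.
  by apply: filterS => m; rewrite E distrC dE.
have far_same a : same_type (prange j) a -> forall m : M S, eps <= mdist (j S m) a.
  move=> /tp_eqP aP m; have jm : prange j S (j S m) by exists m.
  by have := aP (distance_to jm); rewrite !pvalue_distance_to !(metric_sym _ (j S m)) => ->.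
have [|a [aP asep]] := @greedy_pairs (U S) c (same_type (prange j))
    (fun a b => eps <= mdist a b).
  move=> n g gP.
  pose B := iteri n (fun i B => padd B (g i)) (prange j).
  have smB : small K B.
    by rewrite /B; elim: n {gP B} => [|n IH] //=; exact: small_padd.
  have jB : psub (prange j) B.
    by rewrite /B; elim: n {gP B smB} => [|n IH] s b //= jb; left; exact: IH.
  have gB i : (i < n)%N -> B S (g i).
    rewrite /B; elim: n {gP B smB jB} => [//|n IH]; rewrite ltnS leq_eqVlt.
    by case/orP=> [/eqP->|/IH gi]; [right|left].
  have [a aP] := saturated_limit (fun m => mmap j m) satU smB UD.
  have aE : a = single (a None) by apply: env_eq => -[[]|].
  exists (a None); split.
    apply/tp_eqP => -[Delta f d dP]; rewrite -aE.
    have := aP (pwiden jB (PFormula f dP)); rewrite /pvalue /= => ->.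
    exact: limD.
  move=> i i_n; have := aP (distance_to (gB i i_n)).
  rewrite aE pvalue_distance_to metric_sym => ->.
  rewrite -(ulim_cst UD eps); apply: (cvgD_le UD (cvg_cst _)).
    by apply: ulim_cvg => m; exact: feval01.
  apply: filterE => m.
  have mE : mmap j m = single (j S (m None)) by apply: env_eq => -[[]|].
  by rewrite ulim_cst mE pvalue_distance_to; apply: far_same; exact: gP.
have e20 : 0 < eps / 2 by rewrite divr_gt0.
have [n [colour [cn cdist]]] := bounded e20.
have aA i : same_type A (a i) by apply: same_type_sub AM _ (aP i).
have [i [k [ik ck]]] := pigeonhole_colour (fun i => cn _ (aA i)).
by have := cdist _ _ (aA i) (aA k) ck; have := asep i k ik; lra.
Qed.

End AlgebraicParameters.

Theorem proposition7p15 (R : realType) (L : signature R) (T : theory L)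
    (hL : has_canonical_parameter_sorts T)
    (x y : ctx L) (phi : formula (x ++ y)) (hphi : stable T phi)
    (K : Type) (U : structure L) (hU : monster K U)
    (M : structure L) (hM : models M T)
    (j : elementary_embedding M U) (hj : small K (prange j))
    (A : pset U) (hA : psub A (prange j))
    (p : phitype_set phi A) :
  exists q : phitype phi (prange j),
    extends q p /\ definable_over q (acl A).
Proof.
have [KL satU homU] := hU.
have Kinf := language_lt_infinite KL.
have smA : small K A := small_sub hA hj.
have UT : models U T.
  move=> f Tf; rewrite -(hM f Tf) -(eembP j); congr feval.
  by apply: env_eq => -[].
have [S [P canP]] := hL x y phi hphi.
have [Z [[q Zq] ZX Zinv Zbounded]] := totally_bounded_extensions hphi UT p.
have [r [qr rp]] := ZX q Zq.
have [c cq] : exists c : U S, pval P c = q.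
  apply: (canonical_parameter UT canP hphi).
    by move=> b; rewrite qr; exact: tvalue01.
  by rewrite qr; exact: instances_adherent.
(* Realisations of the type of [c] are conjugate to [c], so their predicates are
   translates of [q]. *)
have orbitZ a : same_type c A a -> Z (pval P a).
  move=> ac; have [sigma [sA sc]] := conjugate ac Kinf homU smA.
  have -> : pval P a = pval P c \o (fun b => mmap sigma b).
    by apply: funext => b /=; rewrite -sc pval_aut.
  by rewrite cq; apply: Zinv => //; exists sigma.
have bounded (eps : R) : 0 < eps -> exists n (colour : U S -> nat),
    (forall a, same_type c A a -> (colour a < n)%N) /\
    forall a b, same_type c A a -> same_type c A b -> colour a = colour b ->
      mdist a b <= eps.
  move=> /Zbounded[n [colour [cn cdist]]].
  exists n, (colour \o pval P); split=> [a /orbitZ/cn //|a b /orbitZ Za /orbitZ Zb ab].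
  by apply: (canonical_mdist_le UT canP) => t; exact: cdist.
have c_acl := totally_bounded_acl bounded.
have c_M := acl_in_model bounded Kinf satU hj hA.
pose P_at (B : pset U) (Bc : B S c) : pformula B y :=
  @PFormula R L U B y [:: S] (@fatom R L (y ++ [:: S]) _ P (fun i => tvar i))
    (@esingle _ (carrier U) S c) (inp_single Bc).
have P_atE (B : pset U) (Bc : B S c) b : tvalue (tp B b) (P_at B Bc) = q b.
  by rewrite -cq.
exists (phicl phi (tres (@psub_full R L U (prange j)) r)); split; first by exists r.
exists (fun t => tvalue t (P_at _ c_M)); split.
  split; first exact: tvalue_is_predicate.
  move=> b Bb; rewrite P_atE phi_rel_phicl qr.
  by congr (tvalue r (PFormula _ _)); exact: Prop_irrelevance.
exists (fun t => tvalue t (P_at _ c_acl)); split; first exact: tvalue_is_predicate.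
by move=> b; rewrite !P_atE.
Qed.
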